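(* Let $\mathfrak{S}=\{\phi_i : i\in\Lambda\}$ be a conformal iterated function system on $X=[0,1]^d$ ($d\ge 1$), with $\Lambda$ countable (finite or infinite) having at least two elements, let $J$ be its limit set, $J^\ast\subset J$ the set of points with unique coding, and $T:J^\ast\to J^\ast$ the associated shift map. Let $f:[0,1]^d\to\mathbb{R}^+$ be a positive function. Assume that: (1) $f$ has the tempered distortion property: $\mathrm{Var}_1(f)<\infty$ and $\mathrm{Var}_n(f)\to 0$ as $n\to\infty$; (2) setting $$s(f)=\inf\{s\ge 0: \mathsf{P}(T,-s(\log|T'|+f))\le 0\},$$ one has $s(f)>\dim_{\mathsf H}(J\setminus J^\ast)$. Let $$R(f)=\{x\in J^\ast: |T^nx-x|<e^{-S_nf(x)}\ \text{for infinitely many } n\in\mathbb{N}\},\qquad S_nf(x)=\sum_{k=0}^{n-1}f(T^kx).$$ Then $\dim_{\mathsf H}R(f)=s(f)$.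
   Context: Throughout $X=[0,1]^d$ with the Euclidean norm $|\cdot|$, and $\dim_{\mathsf H}$ is Hausdorff dimension. Iterated function system (IFS): a collection $\mathfrak{S}=\{\phi_i:X\to X,\ i\in\Lambda\}$ of injective contractions, $\Lambda$ countable with at least two elements, that is uniformly contractive: there is $0<\rho<1$ with $|\phi_i(x)-\phi_i(y)|\le\rho|x-y|$ for all $i\in\Lambda$, $x,y\in X$. For $w=(w_1,\dots,w_n)\in\Lambda^n$ put $\phi_w=\phi_{w_1}\circ\cdots\circ\phi_{w_n}$; $\Lambda^*=\bigcup_{n\ge1}\Lambda^n$. The IFS is conformal if: (i) (open set condition) with $U=\mathrm{Int}_{\mathbb{R}^d}(X)$, $\phi_i(U)\subset U$ for all $i$ and $\phi_i(U)\cap\phi_j(U)=\emptyset$ for $i\ne j$; (ii) there is an open connected set $V$ with $X\subset V\subset\mathbb{R}^d$ such that all $\phi_i$ extend to $C^1$ conformal diffeomorphisms of $V$ into $V$; (iii) there are $\gamma,l>0$ such that for every $x\in\partial X$ there is an open cone $C_x\subset\mathrm{Int}(X)$ with vertex $x$, central angle of Lebesgue measure $\gamma$ and altitude $l$; (iv) (bounded distortion property) there is $K\ge1$ with $|\phi_w'(x)|\le K|\phi_w'(y)|$ for all $x,y\in V$, $w\in\Lambda^*$, where $|\phi_w'(x)|$ is the norm of the differential. Coding: for $w\in\Lambda^{\mathbb{N}}$, $\pi(w)$ is the unique point of $\bigcap_{n\ge1}\phi_{w|_n}(X)$, where $w|_n=(w_1,\dots,w_n)$. The limit set is $J=\pi(\Lambda^{\mathbb{N}})$.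 $J^\ast$ is the set of $x\in J$ having exactly one $w\in\Lambda^{\mathbb{N}}$ with $\pi(w)=x$. For $x=\pi(w_1,w_2,\dots)\in J^\ast$, $Tx=\pi(w_2,w_3,\dots)$ and $T'(x)=(\phi_{w_1}'(Tx))^{-1}$. Cylinders: for $w\in\Lambda^n$, $I_n(w)$ is the set of $x\in J$ such that $x=\pi(w')$ for some $w'\in\Lambda^{\mathbb{N}}$ with $w'|_n=w$. $\mathrm{Var}_n(f)=\sup\{|f(x)-f(y)|: w\in\Lambda^n,\ x,y\in I_n(w)\}$. Pressure: for $w=(w_1,\dots,w_n)\in\Lambda^n$ choose any point $x\in I_n(w)$ and write $|(T^n)'([w])|^{-1}=|\phi_w'(\phi_w^{-1}(x))|$ and $S_nf([w])=f(x)+\sum_{k=1}^{n-1}f\big(\phi_{(w_1,\dots,w_k)}^{-1}(x)\big)$. Then for $s\ge0$ $$\mathsf{P}(T,-s(\log|T'|+f))=\lim_{n\to\infty}\frac1n\log\sum_{w\in\Lambda^n}\Big(|(T^n)'([w])|^{-1}e^{-S_nf([w])}\Big)^s,$$ possibly $+\infty$; the value does not depend on the choice of the points $x\in I_n(w)$ when $f$ has the tempered distortion property. *)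

(* Defs.v *)
From HB Require Import structures.
From mathcomp Require Import all_boot all_order all_algebra.
From mathcomp Require Import all_classical all_reals all_analysis.
Set Implicit Arguments.
Unset Strict Implicit.
Unset Printing Implicit Defensive.
Import Order.TTheory GRing.Theory Num.Theory.
Import numFieldNormedType.Exports.
Local Open Scope classical_set_scope.
Local Open Scope ring_scope.

Section Euclidean.
Context {R : realType} {d : nat}.
Local Notation E := 'rV[R]_d.

Definition dotp (x y : E) : R := \sum_(i < d) x 0 i * y 0 i.

(* The library norm of 'rV[R]_d is the sup norm, which has the same open
   sets, continuous maps and differentials as the Euclidean norm below. *)
Definition enorm (x : E) : R := Num.sqrt (dotp x x).

Definition cube : set E := [set x | forall i, 0 <= x 0 i <= 1].

Local Open Scope ereal_scope.

Definition ediam (U : set E) : \bar R :=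
  ereal_sup [set (enorm (p.1 - p.2)%R)%:E | p in U `*` U].

(* diam(U)^s, with 0^0 = 1 for nonempty U, and 0 for empty U. *)
Definition diam_pow (s : R) (U : set E) : \bar R :=
  if U == set0 then 0 else poweR (ediam U) s.

Definition hausdorff_pre (s delta : R) (A : set E) : \bar R :=
  ereal_inf [set \sum_(0 <= k <oo) diam_pow s (U k) | U in
    [set U : nat -> set E |
      A `<=` \bigcup_k U k /\ forall k, ediam (U k) <= delta%:E]].

(* Not normalised: on a k-dimensional surface it is a constant multiple
   (depending only on k) of the surface measure. *)
Definition hausdorff_measure (s : R) (A : set E) : \bar R :=
  ereal_sup [set hausdorff_pre s delta A | delta in
    [set delta : R | (0 < delta)%R]].

(* In particular hausdorff_dim set0 = 0. *)
Definition hausdorff_dim (A : set E) : \bar R :=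
  ereal_inf [set s%:E | s in
    [set s : R | (0 <= s)%R /\ hausdorff_measure s A = 0]].

Local Close Scope ereal_scope.

(* Open circular cone with vertex x, axis u (a unit vector), angle theta
   between the axis and the generatrices, and altitude l. *)
Definition open_cone (x u : E) (theta l : R) : set E :=
  [set y | 0 < dotp (y - x) u < l /\
           cos theta * enorm (y - x) < dotp (y - x) u].

Definition cap (u : E) (theta : R) : set E :=
  [set v | enorm v = 1 /\ cos theta < dotp v u].

(* The measure gamma of the central angle is the (d-1)-dimensional measure
   of the set of directions of the cone (counting measure if d = 1). *)
Definition cone_condition (X : set E) : Prop :=
  exists gamma l : R, [/\ 0 < gamma, 0 < l &
    forall x, (closure X `\` X°) x ->
      exists u theta, [/\ enorm u = 1, 0 < theta < pi / 2,
        hausdorff_measure (d.-1)%:R (cap u theta) = gamma%:E &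
        open_cone x u theta l `<=` X°]].

Definition dnorm (g : E -> E) (x : E) : R :=
  sup [set enorm ('d g x v) | v in [set v | enorm v <= 1]].

Definition C1_on (V : set E) (g : E -> E) : Prop :=
  forall x, V x -> differentiable g x /\ {for x, continuous (jacobian g)}.

(* C^1 conformal diffeomorphism from the open set V onto an open subset of V;
   conformality: every differential is a similarity. *)
Definition conformal_diffeo (V : set E) (g : E -> E) : Prop :=
  [/\ g @` V `<=` V, open (g @` V), C1_on V g,
      exists2 h : E -> E, C1_on (g @` V) h & forall x, V x -> h (g x) = x &
      forall x, V x ->
        exists2 r : R, 0 < r & forall v, enorm ('d g x v) = r * enorm v].

End Euclidean.

Section IFS.
Context {R : realType} {d : nat} {L : countType}.
Local Notation E := 'rV[R]_d.
Variable phi : L -> E -> E.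

Definition phi_word (w : seq L) : E -> E :=
  foldr (fun i g => phi i \o g) idfun w.

(* phi i also denotes the extension of the i-th map of the system beyond the
   cube, when there is one; only its values on the cube matter here. *)
Definition is_ifs : Prop :=
  [/\ exists i j : L, i != j,
      forall i, phi i @` cube `<=` cube,
      forall i, set_inj cube (phi i) &
      exists2 rho : R, 0 < rho < 1 & forall i x y, cube x -> cube y ->
        enorm (phi i x - phi i y) <= rho * enorm (x - y)].

Definition open_set_condition : Prop :=
  (forall i, phi i @` cube° `<=` cube°) /\
  (forall i j, i != j -> (phi i @` cube°) `&` (phi j @` cube°) = set0).

Definition bounded_distortion (V : set E) : Prop :=
  exists2 K : R, 1 <= K & forall w, w != [::] -> forall x y, V x -> V y ->
    dnorm (phi_word w) x <= K * dnorm (phi_word w) y.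

Definition is_conformal_ifs : Prop :=
  [/\ is_ifs, open_set_condition, cone_condition (@cube R d) &
      exists V : set E,
        [/\ open V, connected V, cube `<=` V,
            forall i, conformal_diffeo V (phi i) & bounded_distortion V]].

Definition coding (w : nat -> L) : E :=
  get (\bigcap_(n in [set n | (1 <= n)%N]) (phi_word (mkseq w n) @` cube)).

Definition limit_set : set E := range coding.

Definition limit_set_uniq : set E :=
  [set x | limit_set x /\ exists! w, coding w = x].

(* The shift map; its values off limit_set_uniq are irrelevant. *)
Definition shift_map (x : E) : E :=
  get [set y | exists2 w, coding w = x & y = coding (fun n => w n.+1)].

Definition cylinder (w : seq L) : set E :=
  [set x | exists2 w', coding w' = x & mkseq w' (size w) = w].

Definition cyl_variation (f : E -> R) (n : nat) : \bar R :=
  ereal_sup [set (`|f p.1 - f p.2|)%:E | p in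
    [set p : E * E | exists w : n.-tuple L, cylinder w p.1 /\ cylinder w p.2]].

Definition tempered_distortion (f : E -> R) : Prop :=
  (cyl_variation f 1 < +oo)%E /\ cyl_variation f n @[n --> \oo] --> 0%E.

Definition phi_word_inv (w : seq L) (x : E) : E :=
  get [set y | cube y /\ phi_word w y = x].

(* S_n f([w]) computed at the point x of the cylinder of w *)
Definition word_sum (f : E -> R) (w : seq L) (x : E) : R :=
  f x + \sum_(1 <= k < size w) f (phi_word_inv (take k w) x).

(* The sample points xi w, one in each cylinder, are a parameter. *)
Definition cylinder_choice (xi : seq L -> E) : Prop :=
  forall w, w != [::] -> cylinder w (xi w).

(* P(T, - s (log |T'| + f)) computed with the sample points xi *)
Definition pressure (xi : seq L -> E) (f : E -> R) (s : R) : \bar R :=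
  limn (fun n : nat => (n%:R^-1)%:E * lne (\esum_(w in [set: n.-tuple L])
    ((dnorm (phi_word w) (phi_word_inv w (xi w))
        * expR (- word_sum f w (xi w))) `^ s)%:E))%E.

Definition s_exponent (xi : seq L -> E) (f : E -> R) : \bar R :=
  ereal_inf [set s%:E | s in
    [set s : R | 0 <= s /\ (pressure xi f s <= 0)%E]].

Definition birkhoff_sum (f : E -> R) (n : nat) (x : E) : R :=
  \sum_(0 <= k < n) f (iter k shift_map x).

Definition recurrence_set (f : E -> R) : set E :=
  [set x | limit_set_uniq x /\
    infinite_set [set n : nat |
      enorm (iter n shift_map x - x) < expR (- birkhoff_sum f n x)]].

End IFS.

(* Main.v *)
Require Import Defs.
From HB Require Import structures.
From mathcomp Require Import all_boot all_order all_algebra.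
From mathcomp Require Import all_classical all_reals all_analysis.
From mathcomp Require Import ring lra.
Set Implicit Arguments.
Unset Strict Implicit.
Unset Printing Implicit Defensive.
Import Order.TTheory GRing.Theory Num.Theory.
Import numFieldNormedType.Exports.
Local Open Scope classical_set_scope.
Local Open Scope ring_scope.

(** Let [wnorm w] be the supremum over the cube of the norm of the differential
    of [phi_w], let [low_sum w] be the infimum of the Birkhoff sums of [f] over
    the codings that begin with [w], and put
    [weight w = wnorm w * expR (- low_sum w)].  A point of the cylinder of [w] is
    [x = phi_w y], and it returns when [y] is close to [x]; as [phi_w] is a
    contraction, this determines [y] up to an error of the order of the return
    radius, and then [x] up to an error of order [weight w].  The recurrence set
    is therefore the upper limit of sets of diameter [O(weight w)]
    ([ediam_return_set]), and the question is when
    [\sum_(w of length n) weight w `^ s] is small.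

    Upper bound.  Bounded distortion and tempered distortion make the sums of the
    pressure agree with these level sums up to a factor [expR (o(n))], and the
    level sums are submultiplicative in [n], so the pressure is a true limit by
    Fekete's lemma.  If it is nonpositive at [s0] and [s > s0], some level sum
    with exponent [s] is below 1 ([level_sum_lt1]); then the level sums decay
    exponentially and the covers by return sets have arbitrarily small sums
    ([recurrence_dim_le]).

    Lower bound.  Let [J] be the limit set and [J*] the set of its points with a
    unique coding, and let [t] lie between the dimension of [J \ J*] and the exponent.
    The pressure at [t] is positive, hence for some large [m] there are finitely
    many words of length [m] with [\sum block_weight `^ t > 1]; the distortion
    constants are absorbed in [block_weight], so these blocks can be concatenated
    freely ([blocks_exist]).  On the tree of finite sequences of blocks, mass is
    distributed as follows.  Free blocks are drawn with probabilities
    proportional to [block_weight `^ t].  Since the sum exceeds 1, the mass of a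
    word [u] drops below [(Q u * expR (- cost u)) `^ t] after finitely many free
    blocks, [Q u] being the norm and [cost u] a bound for the Birkhoff sum.  From
    then on the path is forced to repeat its own beginning, until the repeated
    part has norm less than [expR (- cost u)]: this is a return at time [u].  During
    the repetition the mass is constant while the norm is multiplied by about
    [expR (- cost u)], which the mass had already paid for; hence
    [mass u <= C * Q u `^ t] for all [u] ([mass_le]), and every path of positive
    mass returns infinitely often ([path_returns]).

    The image of the cube under [phi_u] contains a ball of radius comparable to
    [wnorm u] ([image_contains_ball]), so by the open set condition the
    midpoints of incomparable cylinders are separated, and a set of diameter [r]
    meets a bounded number of cylinders of size [r].  A cover with a small sum
    of [t]-th powers of diameters is thus avoided by a path of positive mass
    ([mass_distribution]).  The point coded by this path lies in the recurrence set
    or has several codings, so the union of the recurrence set and [J \ J*] is not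
    negligible in dimension [t]; as [J \ J*] is, the recurrence set is not. *)

(** * The Euclidean norm and the mean value inequality *)

Section EuclideanNorm.
Context {R : realType} {d : nat}.
Implicit Types x y z u v : 'rV[R]_d.

Lemma dotpC x y : dotp x y = dotp y x.
Proof. by apply: eq_bigr => i _; rewrite mulrC. Qed.

Lemma dotpDl x y z : dotp (x + y) z = dotp x z + dotp y z.
Proof. by rewrite -big_split; apply: eq_bigr => i _; rewrite mxE mulrDl. Qed.

Lemma dotpZl (a : R) x y : dotp (a *: x) y = a * dotp x y.
Proof. by rewrite mulr_sumr; apply: eq_bigr => i _; rewrite mxE mulrA. Qed.

Lemma dotpDr x y z : dotp z (x + y) = dotp z x + dotp z y.
Proof. by rewrite dotpC dotpDl !(dotpC z). Qed.

Lemma dotpZr (a : R) x y : dotp y (a *: x) = a * dotp y x.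
Proof. by rewrite dotpC dotpZl dotpC. Qed.

Lemma dotp_ge0 x : 0 <= dotp x x.
Proof. by apply: sumr_ge0 => i _; rewrite -expr2 sqr_ge0. Qed.

Lemma enorm_ge0 x : 0 <= enorm x.
Proof. exact: sqrtr_ge0. Qed.

Lemma enorm_sqr x : enorm x ^+ 2 = dotp x x.
Proof. by rewrite sqr_sqrtr ?dotp_ge0. Qed.

Lemma enorm0 : enorm (0 : 'rV[R]_d) = 0.
Proof.
by rewrite /enorm /dotp big1 ?sqrtr0// => i _; rewrite mxE mul0r.
Qed.

Lemma enormZ (a : R) x : enorm (a *: x) = `|a| * enorm x.
Proof.
by rewrite /enorm dotpZl dotpZr mulrA -expr2 sqrtrM ?sqr_ge0// sqrtr_sqr.
Qed.

Lemma enormN x : enorm (- x) = enorm x.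
Proof. by rewrite -scaleN1r enormZ normrN1 mul1r. Qed.

Lemma enormB x y : enorm (x - y) = enorm (y - x).
Proof. by rewrite -opprB enormN. Qed.

Lemma enorm_eq0 x : enorm x = 0 -> x = 0.
Proof.
move=> x0; apply/rowP => i; rewrite mxE; apply/eqP; rewrite -sqrf_eq0.
have : dotp x x = 0 by rewrite -enorm_sqr x0 expr0n.
move/eqP; rewrite psumr_eq0 => [|j _]; last by rewrite -expr2 sqr_ge0.
by move/allP/(_ i); rewrite mem_index_enum expr2 => /(_ isT).
Qed.

(** Cauchy-Schwarz, from the nonnegativity of the square norm of
    [|y|^2 x - <x,y> y]. *)
Lemma dotp_le_enorm x y : dotp x y <= enorm x * enorm y.
Proof.
have [y0|y0] := eqVneq (enorm y) 0.
  rewrite y0 mulr0 (enorm_eq0 y0) /dotp big1// => i _.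
  by rewrite mxE mulr0.
have yp : 0 < enorm y by rewrite lt0r y0 enorm_ge0.
have := dotp_ge0 (enorm y ^+ 2 *: x - dotp x y *: y).
rewrite -scaleNr !(dotpDl, dotpDr, dotpZl, dotpZr) (dotpC y x) -!enorm_sqr.
set b := dotp x y; set a := enorm x; set c := enorm y in yp *.
set t := (X in 0 <= X -> _).
have -> : t = c ^+ 2 * ((a * c) ^+ 2 - b ^+ 2) by rewrite /t; ring.
rewrite pmulr_rge0 ?exprn_gt0// subr_ge0 => h.
have [b0|/ltW b0] := leP b 0.
  by apply: le_trans b0 _; rewrite mulr_ge0 ?enorm_ge0.
by rewrite -(@ler_pXn2r _ 2) ?nnegrE ?mulr_ge0 ?enorm_ge0.
Qed.

Lemma ler_enormD x y : enorm (x + y) <= enorm x + enorm y.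
Proof.
rewrite -(@ler_pXn2r _ 2) ?nnegrE ?addr_ge0 ?enorm_ge0//.
rewrite enorm_sqr !(dotpDl, dotpDr) (dotpC y x) sqrrD -!enorm_sqr.
by have := dotp_le_enorm x y; lra.
Qed.

Lemma ler_enorm_dist z x y : enorm (x - y) <= enorm (x - z) + enorm (z - y).
Proof. by apply: le_trans (ler_enormD _ _); rewrite addrA subrK. Qed.

Lemma coord_le_enorm x i : `|x 0 i| <= enorm x.
Proof.
rewrite -(@ler_pXn2r _ 2) ?nnegrE ?enorm_ge0// enorm_sqr real_normK ?num_real//.
rewrite /dotp (bigD1 i)//= expr2 lerDl; apply: sumr_ge0 => j _.
by rewrite -expr2 sqr_ge0.
Qed.

Lemma enorm_le_sum x : enorm x <= \sum_(i < d) `|x 0 i|.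
Proof.
rewrite -(@ler_pXn2r _ 2) ?nnegrE ?enorm_ge0 ?sumr_ge0// enorm_sqr expr2.
rewrite mulr_suml; apply: ler_sum => i _.
apply: (@le_trans _ _ (`|x 0 i| * `|x 0 i|)).
  by rewrite -normrM ler_norm.
apply: ler_wpM2l => //; rewrite (bigD1 i)//= lerDl; exact: sumr_ge0.
Qed.

Lemma enorm_le_bound x (b : R) : (forall i, `|x 0 i| <= b) -> enorm x <= d%:R * b.
Proof.
move=> h; apply: le_trans (enorm_le_sum x) _.
apply: le_trans (ler_sum _ (fun i _ => h i)) _.
by rewrite sumr_const card_ord mulr_natl.
Qed.

Lemma norm_le_enorm x : `|x| <= enorm x.
Proof.
have [x0|] := eqVneq (mx_norm x) 0; first by rewrite [leLHS]x0 enorm_ge0.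
move=> /mx_norm_neq0[[i j] e]; rewrite [leLHS]e/= ord1; exact: coord_le_enorm.
Qed.

End EuclideanNorm.

Section MeanValue.
Context {R : realType} {d : nat}.
Implicit Types x y z u v : 'rV[R]_d.

Definition dotpl (w : 'rV[R]_d) : 'rV[R]_d -> R^o := fun x => dotp x w.

Lemma dotpl_is_linear w : linear (dotpl w).
Proof. by move=> a x y; rewrite /dotpl dotpDl dotpZl. Qed.

HB.instance Definition _ w :=
  GRing.isLinear.Build R 'rV[R]_d R^o _ (dotpl w) (dotpl_is_linear w).

Lemma dotpl_continuous w : continuous (dotpl w).
Proof.
rewrite /dotpl /dotp; apply: (@continuous_big R^o _ +%R 0 xpredT).
  exact: add_continuous.
by move=> i _ x; apply: cvgMr_tmp (@coord_continuous R 1 d 0 i x).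
Qed.

(** The component of [g] along its own increment is a real function, to which
    the one variable mean value theorem applies. *)
Lemma mean_value_le (g : 'rV[R]_d -> 'rV[R]_d) x v (a c : R) : 0 <= a ->
  (forall t, 0 <= t <= a -> differentiable g (x + t *: v)) ->
  (forall t, 0 <= t <= a -> enorm ('d g (x + t *: v) v) <= c) ->
  enorm (g (x + a *: v) - g x) <= c * a.
Proof.
move=> a0 dg gc.
set w := g (x + a *: v) - g x.
pose l (t : R) : 'rV[R]_d := x + t *: v.
have dl t : is_diff t l ( *:%R^~ v).
  rewrite -[X in is_diff _ _ X]add0r; apply: is_diffD.
pose F : R -> R := dotpl w \o (g \o l).
have dF t : 0 <= t <= a -> is_derive t 1 F (dotp ('d g (l t) v) w).
  move=> ta.
  have dgl : differentiable (g \o l) t.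
    by apply: differentiable_comp; [exact: ex_diff|exact: dg].
  have dd y : differentiable (dotpl w) y.
    exact/linear_differentiable/dotpl_continuous.
  apply: DeriveDef; first exact/derivable1_diffP/differentiable_comp.
  rewrite deriveE; last exact: differentiable_comp.
  rewrite diff_comp// diff_comp//=; last exact: dg.
  by rewrite diff_lin/=; [rewrite diff_val scale1r|exact: dotpl_continuous].
have [||t ta] := @MVT_segment R F (fun t => dotp ('d g (l t) v) w) 0 a a0.
  by move=> t; rewrite in_itv/= => /andP[t0 ta]; apply: dF; rewrite !ltW.
- apply: derivable_within_continuous => t; rewrite in_itv/= => ta.
  by case: (dF _ ta).
rewrite /F/= /l scale0r addr0 subr0 /dotpl => e.
have {e} : enorm w ^+ 2 <= c * a * enorm w.
  rewrite enorm_sqr {1}/w dotpDl -scaleN1r dotpZl mulN1r e.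
  rewrite mulrAC ler_wpM2r//; apply: le_trans (dotp_le_enorm _ _) _.
  by rewrite ler_wpM2r ?enorm_ge0//; apply: gc; rewrite in_itv in ta.
have [->|w0] := eqVneq (enorm w) 0.
  move=> _; rewrite mulr_ge0//; apply: le_trans (enorm_ge0 _) (gc 0 _).
  by rewrite lexx a0.
by rewrite expr2 ler_pM2r// lt0r w0 enorm_ge0.
Qed.
End MeanValue.

(** * Conformal embeddings *)

Section ConformalMaps.
Context {R : realType} {d : nat}.
Hypothesis d_gt0 : (0 < d)%N.
Local Notation E := 'rV[R]_d.
Implicit Types (x y z u v : E) (V O : set E) (g h : E -> E).

Lemma enorm_continuous : continuous (@enorm R d).
Proof.
have c : continuous (fun x : E => dotp x x : R^o).
  rewrite /dotp; apply: (@continuous_big R^o _ +%R 0 xpredT).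
    exact: add_continuous.
  move=> i _ x; apply: (@continuousM R _ (fun x : E => x 0 i)); exact: coord_continuous.
by move=> x; apply: (continuous_comp (c x)); exact: sqrt_continuous.
Qed.

Lemma exists_unit_vector : exists v : E, enorm v = 1.
Proof.
pose v : E := const_mx 1.
have v0 : enorm v != 0.
  apply/eqP => /enorm_eq0 /rowP/(_ (Ordinal d_gt0)).
  by rewrite !mxE => /eqP; rewrite oner_eq0.
exists ((enorm v)^-1 *: v).
by rewrite enormZ ger0_norm ?invr_ge0 ?enorm_ge0// mulVf.
Qed.

(** The norm of the differential of a similarity is its ratio. *)
Lemma dnorm_similarity g x (r : R) : 0 <= r ->
  (forall v, enorm ('d g x v) = r * enorm v) -> dnorm g x = r.
Proof.
move=> r0 hr; apply/eqP; rewrite eq_le /dnorm; apply/andP; split.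
  apply: ge_sup.
    by exists (enorm ('d g x 0)); exists 0 => //=; rewrite enorm0 ler01.
  by move=> _ [v /= v1 <-]; rewrite hr ler_piMr.
have [v v1] := exists_unit_vector.
apply: ub_le_sup; last by exists v => /=; rewrite ?v1 ?hr ?v1 ?mulr1.
by exists r => _ [u /= u1 <-]; rewrite hr ler_piMr.
Qed.

(** The part of being a conformal diffeomorphism of [V] into itself that
    compositions of the maps of the system inherit and that is used below. *)
Definition conformal_embedding V g := exists h,
  [/\ forall x, V x -> V (g x),
      forall O, open O -> O `<=` V -> open (g @` O),
      forall x, V x -> [/\ h (g x) = x, differentiable g x &
         differentiable h (g x)] &
      forall x, V x ->
        0 < dnorm g x /\ forall v, enorm ('d g x v) = dnorm g x * enorm v].

(** An image under [g] is the preimage under the continuous inverse [h], inside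
    an open set; this is why [g] is an open map. *)
Lemma conformal_embedding_diffeo V g : conformal_diffeo V g ->
  conformal_embedding V g.
Proof.
move=> [gV ogV gC1 [h hC1 hg] gsim]; exists h; split.
- by move=> x Vx; apply: gV; exists x.
- move=> O oO OV.
  have -> : g @` O = (g @` V) `&` h @^-1` O.
    apply/seteqP; split => [_ [x Ox <-]|_ [[x Vx <-]]].
      by split; [exists x => //; exact: OV|rewrite /preimage/= hg//; exact: OV].
    by rewrite /preimage/= hg// => Ox; exists x.
  rewrite openE => y [gVy hOy].
  have hc : {for y, continuous h}.
    by apply: differentiable_continuous; have [] := hC1 y gVy.
  apply: filterI; first exact: open_nbhs_nbhs.
  by apply: hc; exact: open_nbhs_nbhs.
- move=> x Vx; have [? _] := gC1 x Vx; split => //; first exact: hg.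
  by have [] := hC1 (g x); first by exists x.
- move=> x Vx; have [r r0 hr] := gsim x Vx.
  by rewrite (dnorm_similarity (ltW r0) hr).
Qed.

Lemma diff_id_fun x : 'd (@idfun E) x = idfun :> (E -> E).
Proof. by rewrite diff_lin//= => ? . Qed.

Lemma dnorm_id x : dnorm (@idfun E) x = 1.
Proof.
by apply: dnorm_similarity => // v; rewrite diff_id_fun mul1r.
Qed.

Lemma conformal_embedding_id V : conformal_embedding V idfun.
Proof.
exists idfun; split => //.
- by move=> O oO _; rewrite image_id.
- by move=> x _; rewrite dnorm_id; split => // v; rewrite diff_id_fun mul1r.
Qed.

Lemma conformal_embedding_diff V g x : conformal_embedding V g -> V x ->
  differentiable g x.
Proof. by move=> [h [_ _ hg _]] /hg[]. Qed.

Lemma conformal_embedding_dnorm V g x : conformal_embedding V g -> V x ->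
  0 < dnorm g x.
Proof. by move=> [h [_ _ _ hg]] /hg[]. Qed.

Lemma conformal_embedding_sim V g x v : conformal_embedding V g -> V x ->
  enorm ('d g x v) = dnorm g x * enorm v.
Proof. by move=> [h [_ _ _ hg]] /hg[]. Qed.

Lemma dnorm_comp V g1 g2 x : conformal_embedding V g1 ->
  conformal_embedding V g2 -> V x ->
  dnorm (g1 \o g2) x = dnorm g1 (g2 x) * dnorm g2 x.
Proof.
move=> c1 c2 Vx; have [_ [g2V _ _ _]] := c2; have Vg2 := g2V _ Vx.
apply: dnorm_similarity.
  by rewrite mulr_ge0// ltW//; exact: conformal_embedding_dnorm Vx ||
    exact: conformal_embedding_dnorm Vg2.
move=> v; rewrite diff_comp; last 2 first.
- exact: conformal_embedding_diff Vx.
- exact: conformal_embedding_diff Vg2.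
rewrite /= (conformal_embedding_sim _ c1 Vg2) (conformal_embedding_sim _ c2 Vx).
by rewrite mulrA.
Qed.

Lemma conformal_embedding_comp V g1 g2 : conformal_embedding V g1 ->
  conformal_embedding V g2 -> conformal_embedding V (g1 \o g2).
Proof.
move=> c1 c2; have [h1 [g1V o1 k1 s1]] := c1; have [h2 [g2V o2 k2 s2]] := c2.
exists (h2 \o h1); split.
- by move=> x Vx; exact/g1V/g2V.
- move=> O oO OV; rewrite -image_comp; apply: o1; first exact: o2.
  by move=> _ [x Ox <-]; exact/g2V/OV.
- move=> x Vx; have [e1 d1 d1'] := k1 _ (g2V _ Vx); have [e2 d2 d2'] := k2 _ Vx.
  split; first by rewrite /= e1.
    exact: differentiable_comp.
  by apply: differentiable_comp => //=; rewrite e1.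
- move=> x Vx; rewrite (dnorm_comp c1 c2 Vx).
  have [p1 _] := s1 _ (g2V _ Vx); have [p2 _] := s2 _ Vx.
  split; first by rewrite (mulr_gt0 p1 p2).
  move=> v; have [_ d1 _] := k1 _ (g2V _ Vx); have [_ d2 _] := k2 _ Vx.
  rewrite diff_comp//= (conformal_embedding_sim _ c1 (g2V _ Vx)).
  by rewrite (conformal_embedding_sim _ c2 Vx) mulrA.
Qed.

Lemma diff_locally_id (k : E -> E) y v : differentiable k y ->
  (\forall z \near y, k z = z) -> 'd k y v = v.
Proof.
move=> dk kid; rewrite -deriveE// /derive; apply: lim_near_cst => //.
have c : {for (0 : R), continuous (fun t : R => t *: v + y)}.
  apply: continuousD; last exact: cst_continuous.
  exact: scalel_continuous.
have {}kid : \forall z \near (0 : R) *: v + y, k z = z by rewrite scale0r add0r.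
have h0 : \forall t \near (0 : R)^', k (t *: v + y) = t *: v + y.
  by apply: cvg_within; apply: c kid.
have hn : \forall t \near (0 : R)^', t != 0 by exact: nbhs_dnbhs_neq.
near=> t => /=.
have -> : k (t *: v + y) = t *: v + y by near: t.
have -> : k y = y by move/nbhs_singleton: kid; rewrite scale0r add0r.
by rewrite addrK scalerA mulVf ?scale1r//; near: t.
Unshelve. all: by end_near. Qed.

(** [g] after [h] is the identity near [g x], so the differentials there are
    mutually inverse similarities. *)
Lemma inverse_diff_enorm V g h x v : open (g @` V) -> V x ->
  (forall z, V z -> h (g z) = z) -> conformal_embedding V g ->
  differentiable h (g x) -> enorm ('d h (g x) v) = enorm v / dnorm g x.
Proof.
move=> ogV Vx hg cg dh.
have gp := conformal_embedding_dnorm cg Vx.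
have dgh : differentiable g (h (g x)).
  by rewrite hg//; exact: conformal_embedding_diff Vx.
have e : 'd (g \o h) (g x) v = v.
  apply: diff_locally_id; first exact: differentiable_comp.
  have : nbhs (g x) (g @` V) by apply: open_nbhs_nbhs; split => //; exists x.
  by apply: filterS => _ [z Vz <-]; rewrite /= hg.
rewrite (diff_comp dh dgh) /= (hg x Vx) in e.
have <- := etrans (esym (conformal_embedding_sim ('d h (g x) v) cg Vx))
  (congr1 enorm e).
by rewrite mulrC mulKf// gt_eqF.
Qed.

(** A path lifting argument: the segment from [g x0] to [y] is followed by its
    preimage under [g], which moves at speed at most [enorm (y - g x0) / k] and
    so cannot leave the ball of radius [r] before the segment is exhausted. *)
Lemma image_contains_ball V g x0 (k r : R) : open V -> conformal_embedding V g ->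
  (forall x, enorm (x - x0) <= r -> V x) -> 0 < k ->
  (forall x, V x -> k <= dnorm g x) -> 0 < r ->
  forall y, enorm (y - g x0) < k * r -> exists2 x, enorm (x - x0) < r & g x = y.
Proof.
move=> oV cg BV k0 kg r0 y yr.
have [h [gV og hg gsim]] := cg.
pose B := [set x : E | enorm (x - x0) <= r].
pose B' := [set x : E | enorm (x - x0) < r].
have ec : continuous (fun x : E => enorm (x - x0)).
  move=> x; apply: continuous_comp; last exact: enorm_continuous.
  by apply: continuousB => //; exact: cst_continuous.
have Bx0 : B x0 by rewrite /B/= subrr enorm0 ltW.
have cB : compact B.
  apply: bounded_closed_compact.
    exists (enorm x0 + r); split; first exact: num_real.
    move=> M hM x /= xB; apply: le_trans (norm_le_enorm _) _.
    apply: le_trans (ltW hM); rewrite -[x in leLHS](subrK x0) addrC.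
    by apply: le_trans (ler_enormD _ _) _; rewrite lerD2l.
  have -> : B = (fun x : E => enorm (x - x0)) @^-1` [set t | t <= r] by [].
  by apply: (closed_comp (fun x _ => ec x)); exact: closed_le.
have oB' : open B'.
  have -> : B' = (fun x : E => enorm (x - x0)) @^-1` [set t | t < r] by [].
  by apply: open_comp => [x _|]; [exact: ec|exact: open_lt].
have B'B : B' `<=` B by move=> x; exact: ltW.
pose A := g @` B.
have cA : closed A.
  apply: compact_closed; first exact: norm_hausdorff.
  apply: continuous_compact => //; apply/continuous_in_subspaceT => x.
  rewrite inE => /BV Vx; apply: differentiable_continuous.
  exact: conformal_embedding_diff Vx.
have oA' : open (g @` B') by apply: og => // x /B'B/BV.
pose c (t : R) : E := g x0 + t *: (y - g x0).
have cc : forall t, {for t, continuous c}.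
  rewrite /c => t; apply: continuousD; first exact: cst_continuous.
  exact: scalel_continuous.
pose S := [set t : R | 0 <= t <= 1 /\ forall s, 0 <= s <= t -> A (c s)].
have S0 : S 0.
  split; first by rewrite lexx ler01.
  move=> s; rewrite -eq_le => /eqP <-; exists x0 => //.
  by rewrite /c scale0r addr0.
have hS : has_sup S.
  by split; [exists 0|exists 1 => t [/andP[]]].
pose T := sup S.
have T0 : 0 <= T by exact: (ub_le_sup hS.2 S0).
have T1 : T <= 1 by apply: ge_sup => [|t [/andP[]]//]; exists 0.
have lift t : 0 <= t <= 1 -> (forall s, 0 <= s <= t -> A (c s)) ->
    exists2 x, B' x & g x = c t.
  move=> /andP[t0 t1] At.
  have [x Bx gx] := At t (ltac:(by rewrite t0 lexx)).
  exists x => //.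
  have hA z : A z -> differentiable h z /\
      forall v, enorm ('d h z v) <= enorm v / k.
    move=> [u Bu <-]; have Vu := BV u Bu; have [_ _ dh] := hg u Vu; split => // v.
    rewrite (inverse_diff_enorm _ _ Vu _ cg)//; first last.
    - by move=> w /hg[].
    - by apply: og.
    rewrite ler_wpM2l ?enorm_ge0// lef_pV2 ?posrE//; first exact: kg.
    by apply: lt_le_trans (kg _ Vu).
  have := @mean_value_le R d h (g x0) (y - g x0) t (enorm (y - g x0) / k) t0.
  rewrite -/(c t) -gx; have [-> _ _] := hg x (BV x Bx).
  have [-> _ _] := hg x0 (BV x0 Bx0).
  move=> hle; apply: le_lt_trans (hle _ _) _.
  - by move=> s st; have [] := hA _ (At s st).
  - by move=> s st; have [_] := hA _ (At s st); exact.
  rewrite mulrAC ltr_pdivrMr//; apply: le_lt_trans (_ : enorm (y - g x0) < _).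
    by rewrite ler_piMr ?enorm_ge0.
  by rewrite mulrC.
have AT : forall s, 0 <= s <= T -> A (c s).
  move=> s /andP[s0]; rewrite le_eqVlt => /orP[/eqP ->|sT]; last first.
    have sT' : 0 < T - s by rewrite subr_gt0.
    have [t St st] := sup_adherent sT' hS.
    rewrite subKr in st; have [_ At] := St; apply: At.
    by rewrite s0 ltW.
  apply: contrapT => nA.
  have : nbhs T (c @^-1` ~` A).
    by apply: cc; apply: open_nbhs_nbhs; split => //; exact: closed_openC.
  move=> /nbhs_ballP[e /= e0 he].
  have [t St tT] := sup_adherent e0 hS.
  have tT' : t <= T by exact: (ub_le_sup hS.2 St).
  have [/andP[t0 _] At] := St; apply: (he t); last by apply: At; rewrite t0 lexx.
  by rewrite /ball/= ger0_norm ?subr_ge0// ltrBlDr -ltrBlDl.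
have [x Bx gx] := lift T (ltac:(by rewrite T0 T1)) AT.
have [T1'|T1'] := eqVneq T 1.
  by exists x => //; rewrite gx T1' /c scale1r addrC subrK.
have {T1'}Tl1 : T < 1 by rewrite lt_neqAle T1'.
have : nbhs T (c @^-1` (g @` B')).
  by apply: cc; apply: open_nbhs_nbhs; split => //; exists x.
move=> /nbhs_ballP[e /= e0 he].
have Se : S (Order.min (T + e / 2) 1).
  split; first by rewrite le_min ler01 ge_min lexx orbT !andbT addr_ge0// ltW// divr_gt0.
  move=> s /andP[s0 se]; have [sT|Ts] := leP s T; first by apply: AT; rewrite s0.
  have [|z zB <-] := he s; last by exists z => //; exact: B'B.
  rewrite /ball/= distrC ger0_norm ?subr_ge0 ?ltW//.
  move: se; rewrite le_min => /andP[se _].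
  by apply: le_lt_trans (_ : e / 2 < _); [lra|rewrite ltr_pdivrMr// ltr_pMr// ltr1n].
have : T < Order.min (T + e / 2) 1 by rewrite lt_min Tl1 ltrDl divr_gt0.
by rewrite ltNge (ub_le_sup hS.2 Se).
Qed.

End ConformalMaps.

(** * Derivatives of words over the cube *)

Section Cube.
Context {R : realType} {d : nat}.
Hypothesis d_gt0 : (0 < d)%N.
Local Notation E := 'rV[R]_d.
Implicit Types x y : E.

Definition midcube : E := const_mx 2^-1.

Lemma cube_convex x y (t : R) : cube x -> cube y -> 0 <= t <= 1 ->
  cube (x + t *: (y - x)).
Proof.
move=> cx cy /andP[t0 t1] i; rewrite !mxE.
by have /andP[? ?] := cx i; have /andP[? ?] := cy i; nra.
Qed.

Lemma enorm_cube_le x y : cube x -> cube y -> enorm (x - y) <= d%:R.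
Proof.
move=> cx cy; rewrite -[leRHS]mulr1; apply: enorm_le_bound => i; rewrite !mxE.
have /andP[? ?] := cx i; have /andP[? ?] := cy i; rewrite ler_norml; lra.
Qed.

Lemma ball_midcube_cube x : enorm (x - midcube) <= 2^-1 -> cube x.
Proof.
move=> h i; have := le_trans (coord_le_enorm (x - midcube) i) h.
rewrite !mxE ler_norml; lra.
Qed.

Lemma cube_midcube : cube midcube.
Proof. by apply: ball_midcube_cube; rewrite subrr enorm0. Qed.

Lemma ball_midcube_interior x : enorm (x - midcube) < 2^-1 -> (@cube R d)° x.
Proof.
move=> h; pose B := [set y : E | enorm (y - midcube) < 2^-1].
suff oB : open B.
  have : nbhs x B by apply: open_nbhs_nbhs; split.
  by apply: filterS => y /ltW; exact: ball_midcube_cube.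
have -> : B = (fun y : E => enorm (y - midcube)) @^-1` [set t | t < 2^-1] by [].
apply: open_comp => [y _|]; last exact: open_lt.
apply: continuous_comp; last exact: enorm_continuous.
by apply: continuousB => //; exact: cst_continuous.
Qed.

Lemma cube_compact : compact (@cube R d).
Proof.
rewrite (_ : cube = [set v : E | forall i, `[0, 1]%classic (v 0 i)]).
  by apply: (rV_compact (A := fun=> `[0 : R, 1]%classic)) => i; exact: segment_compact.
by apply/seteqP; split => v h i; have := h i; rewrite /= ?in_itv.
Qed.

(** For [x] in the cube this gives a direction pointing into the cube, along which
    the contraction of the maps bounds their differentials. *)
Lemma cube_other x : exists y, cube y /\ 0 < enorm (y - x).
Proof.
have pos u : u != 0 :> E -> 0 < enorm u.
  by move=> u0; rewrite lt0r enorm_ge0 andbT; apply: contra_neq u0; exact: enorm_eq0.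
have [xc|xc] := eqVneq x midcube; last first.
  by exists midcube; split; [exact: cube_midcube|apply: pos; rewrite subr_eq0 eq_sym].
exists 0; split; first by move=> i; rewrite mxE lexx ler01.
apply: pos; rewrite sub0r oppr_eq0 xc; apply/eqP => /rowP/(_ (Ordinal d_gt0)).
by rewrite !mxE => /eqP; rewrite invr_eq0 pnatr_eq0.
Qed.

End Cube.

Section System.
Context {R : realType} {d : nat} {L : countType}.
Hypothesis d_gt0 : (0 < d)%N.
Local Notation E := 'rV[R]_d.
Variable phi : L -> E -> E.
Local Notation phiw := (phi_word phi).
Implicit Types (x y z : E) (u v w : seq L).

(** A conformal system with its constants exposed.  On [V] the maps are only
    required to be embeddings with similarities as differentials, a property that
    all words inherit. *)
Record conformal_data (rho K : R) (V : set E) : Prop := ConformalData {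
  cd_cube : forall i x, cube x -> cube (phi i x);
  cd_inj : forall i, set_inj cube (phi i);
  cd_rho : 0 < rho < 1;
  cd_contr : forall i x y, cube x -> cube y ->
    enorm (phi i x - phi i y) <= rho * enorm (x - y);
  cd_int : forall i x, cube° x -> cube° (phi i x);
  cd_sep : forall i j x y, i != j -> cube° x -> cube° y -> phi i x <> phi j y;
  cd_open : open V;
  cd_cubeV : cube `<=` V;
  cd_emb : forall i, conformal_embedding V (phi i);
  cd_K : 1 <= K;
  cd_distortion : forall w, w != [::] -> forall x y, V x -> V y ->
    dnorm (phiw w) x <= K * dnorm (phiw w) y }.

Lemma conformal_ifs_data : is_conformal_ifs phi ->
  exists rho K V, conformal_data rho K V.
Proof.
move=> [[_ pc pi [rho r1 rc]] [osc1 osc2] _ [V [oV _ cV pV [K K1 bd]]]].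
exists rho, K, V; split => //.
- by move=> i x cx; apply: pc; exists x.
- by move=> i x cx; apply: osc1; exists x.
- move=> i j x y ij cx cy e; have := osc2 i j ij.
  by rewrite -subset0 => /(_ (phi i x)); apply; split; [exists x|exists y].
- by move=> i; exact: conformal_embedding_diffeo (pV i).
Qed.

Variables (rho K : R) (V : set E).
Hypothesis cd : conformal_data rho K V.

Let rho_gt0 : 0 < rho. Proof. by have /andP[] := cd_rho cd. Qed.
Let rho_lt1 : rho < 1. Proof. by have /andP[] := cd_rho cd. Qed.
Let K_gt0 : 0 < K. Proof. by apply: lt_le_trans (cd_K cd). Qed.

Lemma phi_word_cat u v x : phiw (u ++ v) x = phiw u (phiw v x).
Proof. by elim: u => //= i u ->. Qed.

Lemma phi_word_catE u v : phiw (u ++ v) = phiw u \o phiw v.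
Proof. by apply/funext => x /=; exact: phi_word_cat. Qed.

Lemma phi_word_cube w x : cube x -> cube (phiw w x).
Proof. by move=> cx; elim: w => //= i w; exact: (cd_cube cd). Qed.

Lemma phi_word_interior w x : cube° x -> cube° (phiw w x).
Proof. by move=> cx; elim: w => //= i w; exact: (cd_int cd). Qed.

Lemma phi_word_inj w x y : cube x -> cube y -> phiw w x = phiw w y -> x = y.
Proof.
move=> cx cy; elim: w => //= i w IH e; apply: IH.
by apply: (cd_inj cd) e; rewrite inE; exact: phi_word_cube.
Qed.

Lemma phi_word_contr w x y : cube x -> cube y ->
  enorm (phiw w x - phiw w y) <= rho ^+ size w * enorm (x - y).
Proof.
move=> cx cy; elim: w => /= [|i w IH]; first by rewrite expr0 mul1r.
apply: le_trans (cd_contr cd i (phi_word_cube w cx) (phi_word_cube w cy)) _.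
by rewrite exprS -mulrA ler_pM2l.
Qed.

Lemma phi_word_emb w : conformal_embedding V (phiw w).
Proof.
elim: w => [|i w IH] /=; first exact: conformal_embedding_id.
exact: conformal_embedding_comp (cd_emb cd i) IH.
Qed.

Lemma phi_word_diff w x : cube x -> differentiable (phiw w) x.
Proof.
by move=> /(cd_cubeV cd) Vx; exact: conformal_embedding_diff (phi_word_emb w) Vx.
Qed.

Lemma dnorm_word_gt0 w x : V x -> 0 < dnorm (phiw w) x.
Proof. exact: conformal_embedding_dnorm (phi_word_emb w). Qed.

Lemma dnorm_word_distortion w x y : V x -> V y ->
  dnorm (phiw w) x <= K * dnorm (phiw w) y.
Proof.
move=> Vx Vy; have [->|w0] := eqVneq w [::]; last exact: (cd_distortion cd).
by rewrite /= !dnorm_id// mulr1 (cd_K cd).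
Qed.

(** The differential at [x] is a similarity, so its ratio can be read off along
    a segment that stays in the cube, where the map contracts. *)
Lemma dnorm_word_le w x : cube x -> dnorm (phiw w) x <= rho ^+ size w.
Proof.
move=> cx; have [y [cy yx]] := cube_other d_gt0 x.
have dw := phi_word_diff w cx.
set v := y - x in yx.
suff : enorm ('D_v (phiw w) x) <= rho ^+ size w * enorm v.
  rewrite deriveE// (conformal_embedding_sim _ (phi_word_emb w) (cd_cubeV cd cx)).
  by rewrite ler_pM2r.
have dv : derivable (phiw w) x v by exact: diff_derivable.
have ld : (fun h : R => h^-1 *: ((phiw w \o shift x) (h *: v) - phiw w x))
    @ 0^'+ --> 'D_v (phiw w) x.
  exact: cvg_dnbhs_at_right dv.
have le := continuous_cvg _ (@enorm_continuous R d ('D_v (phiw w) x)) ld.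
apply: (cvgr_to_le (le _)).
near=> h; have h0 : 0 < h by [].
have h1 : h <= 1 by near: h; apply: nbhs_right_le.
rewrite /= enormZ gtr0_norm ?invr_gt0// ler_pdivrMl// (addrC (h *: v)).
apply: le_trans (phi_word_contr w _ cx) _; first by apply: cube_convex; rewrite // h1 ltW.
by rewrite addrAC subrr add0r enormZ gtr0_norm// mulrCA.
Unshelve. all: by end_near. Qed.

(** Taking a supremum over the cube, rather than the norm at one point, gives
    submultiplicativity with constant 1. *)
Definition wnorm (w : seq L) : R := sup [set dnorm (phiw w) x | x in cube].

Let has_sup_wnorm w : has_sup [set dnorm (phiw w) x | x in cube].
Proof.
split.
  by exists (dnorm (phiw w) midcube); exists midcube => //; exact: cube_midcube.
by exists (rho ^+ size w) => _ [x cx <-]; exact: dnorm_word_le.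
Qed.

Lemma dnorm_le_wnorm w x : cube x -> dnorm (phiw w) x <= wnorm w.
Proof. by move=> cx; apply: (ub_le_sup (has_sup_wnorm w).2); exists x. Qed.

Lemma wnorm_lub w (b : R) : (forall x, cube x -> dnorm (phiw w) x <= b) ->
  wnorm w <= b.
Proof.
by move=> h; apply: ge_sup; [exact: (has_sup_wnorm w).1|move=> _ [x cx <-]; exact: h].
Qed.

Lemma wnorm_le_dnorm w x : V x -> wnorm w <= K * dnorm (phiw w) x.
Proof.
move=> Vx; apply: wnorm_lub => y cy; apply: dnorm_word_distortion => //.
exact: (cd_cubeV cd).
Qed.

Lemma wnorm_gt0 w : 0 < wnorm w.
Proof.
apply: lt_le_trans (dnorm_le_wnorm w cube_midcube).
by apply: dnorm_word_gt0; exact: (cd_cubeV cd cube_midcube).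
Qed.

Lemma wnorm_le w : wnorm w <= rho ^+ size w.
Proof. by apply: wnorm_lub => x; exact: dnorm_word_le. Qed.

Lemma wnorm_le1 w : wnorm w <= 1.
Proof. by apply: le_trans (wnorm_le w) _; rewrite exprn_ile1 ?ltW. Qed.

Lemma wnorm_nil : wnorm [::] = 1.
Proof.
apply/eqP; rewrite eq_le wnorm_le1/=.
by apply: le_trans (dnorm_le_wnorm [::] cube_midcube); rewrite /= dnorm_id.
Qed.

Lemma dnorm_word_cat u v x : cube x ->
  dnorm (phiw (u ++ v)) x = dnorm (phiw u) (phiw v x) * dnorm (phiw v) x.
Proof.
move=> cx; rewrite phi_word_catE.
exact: dnorm_comp (phi_word_emb u) (phi_word_emb v) (cd_cubeV cd cx).
Qed.

Lemma wnorm_cat_le u v : wnorm (u ++ v) <= wnorm u * wnorm v.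
Proof.
apply: wnorm_lub => x cx; rewrite dnorm_word_cat//.
have Vx := cd_cubeV cd cx; have cvx := phi_word_cube v cx.
apply: ler_pM; [exact/ltW/dnorm_word_gt0/(cd_cubeV cd)|
  exact/ltW/dnorm_word_gt0| exact: dnorm_le_wnorm| exact: dnorm_le_wnorm].
Qed.

(** The converse of [wnorm_cat_le] costs one distortion constant. *)
Lemma wnorm_cat_ge u v : wnorm u * wnorm v <= K * wnorm (u ++ v).
Proof.
rewrite -ler_pdivlMl ?wnorm_gt0//; apply: wnorm_lub => x cx.
rewrite ler_pdivlMl ?wnorm_gt0//.
have Vx := cd_cubeV cd cx; have cvx := phi_word_cube v cx.
apply: le_trans (_ : K * dnorm (phiw (u ++ v)) x <= _); last first.
  by rewrite ler_pM2l//; exact: dnorm_le_wnorm.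
rewrite dnorm_word_cat// mulrA ler_pM2r ?dnorm_word_gt0//.
exact/wnorm_le_dnorm/(cd_cubeV cd).
Qed.

(** Mean value inequality on the cube, which is convex. *)
Lemma phi_word_lipschitz w x y : cube x -> cube y ->
  enorm (phiw w x - phiw w y) <= wnorm w * enorm (x - y).
Proof.
move=> cx cy.
have h t : 0 <= t <= 1 -> cube (y + t *: (x - y)) by exact: cube_convex.
have := @mean_value_le R d (phiw w) y (x - y) 1 (wnorm w * enorm (x - y)) ler01.
rewrite scale1r (addrC y) subrK mulr1; apply.
  by move=> t /h ct; exact: phi_word_diff.
move=> t /h ct; rewrite (conformal_embedding_sim _ (phi_word_emb w) (cd_cubeV cd ct)).
by rewrite ler_wpM2r ?enorm_ge0 ?dnorm_le_wnorm.
Qed.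

(** The open set condition is applied at the first letter where the words
    differ, after cancelling the common prefix by injectivity. *)
Lemma phi_word_disjoint u v x y : ~~ prefix u v -> ~~ prefix v u ->
  cube° x -> cube° y -> phiw u x <> phiw v y.
Proof.
move=> + + cx cy; elim: u v => [|i u IH] [|j v]//=.
rewrite (eq_sym j); have [<-/=|ij _ _] := eqVneq i j; last first.
  exact: (cd_sep cd) ij (phi_word_interior u cx) (phi_word_interior v cy).
move=> uv vu e; apply: (IH _ uv vu).
by apply: (cd_inj cd) e; rewrite inE; apply: phi_word_cube; exact: interior_subset.
Qed.

(** By the open set condition the centre of the second cylinder lies outside
    the image of the interior of the cube under the first map, and this image
    contains a ball of radius comparable to [wnorm u]. *)
Lemma cylinder_midpoints_separated u v : ~~ prefix u v -> ~~ prefix v u ->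
  (4 * K)^-1 * wnorm u <= enorm (phiw v midcube - phiw u midcube).
Proof.
move=> uv vu; rewrite leNgt; apply/negP => h.
have [|||||x xr e] := @image_contains_ball R d V (phiw u) midcube (wnorm u / K) 4^-1
    (cd_open cd) (phi_word_emb u) _ _ _ _ (phiw v midcube).
- move=> x hx; apply: (cd_cubeV cd); apply: ball_midcube_cube.
  by apply: le_trans hx _; lra.
- by rewrite divr_gt0 ?wnorm_gt0.
- by move=> x Vx; rewrite ler_pdivrMr// mulrC; exact: wnorm_le_dnorm.
- by lra.
- by apply: lt_le_trans h _; rewrite (mulrC _ (wnorm u)) -mulrA -invfM (mulrC K).
apply: (@phi_word_disjoint u v x midcube) => //.
  by apply: ball_midcube_interior; apply: lt_trans xr _; lra.
by apply: ball_midcube_interior; rewrite subrr enorm0 invr_gt0.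
Qed.

End System.

(** * Codings and Birkhoff sums *)

Section Sequences.
Context {L : Type}.
Implicit Types (u v : seq L) (om : nat -> L).

Definition shiftn n om : nat -> L := fun k => om (n + k)%N.

Definition catw u om : nat -> L := fun n => nth (om (n - size u)%N) u n.

Lemma shiftn0 om : shiftn 0 om = om.
Proof. by []. Qed.

Lemma shiftnD m n om : shiftn m (shiftn n om) = shiftn (n + m) om.
Proof. by apply/funext => k; rewrite /shiftn addnA. Qed.

Lemma mkseqD m n om : mkseq om (m + n) = mkseq om m ++ mkseq (shiftn m om) n.
Proof.
rewrite /mkseq iotaD map_cat; congr (_ ++ _).
by rewrite add0n -[in LHS](addn0 m) iotaDl -map_comp.
Qed.

Lemma mkseq_catw u om : mkseq (catw u om) (size u) = u.
Proof.
apply: (@eq_from_nth _ (om 0%N)); rewrite size_mkseq// => i iu.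
by rewrite nth_mkseq// /catw; exact: set_nth_default.
Qed.

Lemma shiftn_catw u om : shiftn (size u) (catw u om) = om.
Proof.
by apply/funext => k; rewrite /shiftn /catw addKn nth_default// leq_addr.
Qed.

Lemma mkseq_shiftn om om' m n : mkseq om (m + n) = mkseq om' (m + n) ->
  mkseq (shiftn m om) n = mkseq (shiftn m om') n.
Proof.
by move=> /(congr1 (drop m)); rewrite !mkseqD !drop_size_cat ?size_mkseq.
Qed.

End Sequences.

Section Coding.
Context {R : realType} {d : nat} {L : countType}.
Hypothesis d_gt0 : (0 < d)%N.
Local Notation E := 'rV[R]_d.
Variable phi : L -> E -> E.
Local Notation phiw := (phi_word phi).
Variables (rho K : R) (V : set E).
Hypothesis cd : conformal_data phi rho K V.
Implicit Types (x y z : E) (u v : seq L) (om : nat -> L).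

Local Notation pi := (coding phi).

Lemma cylinder_compact u : compact (phiw u @` cube).
Proof.
apply: continuous_compact; last exact: cube_compact.
apply/continuous_in_subspaceT => x; rewrite inE => cx.
exact/differentiable_continuous/(phi_word_diff d_gt0 cd).
Qed.

Lemma mem_cylinderS om m n x : (phiw (mkseq om (m + n)) @` cube) x ->
  (phiw (mkseq om m) @` cube) x.
Proof.
rewrite mkseqD => -[y cy <-]; rewrite phi_word_cat.
by exists (phiw (mkseq (shiftn m om) n) y) => //; exact: (phi_word_cube cd).
Qed.

(** Nested compact sets: an accumulation point of the images of the midpoint
    lies in all of them. *)
Lemma coding_mem om n : (phiw (mkseq om n) @` cube) (pi om).
Proof.
suff : exists x, (\bigcap_(n in [set n | (1 <= n)%N])
    (phiw (mkseq om n) @` cube)) x.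
  move=> /getPex h; apply: (@mem_cylinderS om n 1); rewrite addn1.
  exact: h.
pose a n : E := phiw (mkseq om n) midcube.
have cc : cube (midcube : E) := cube_midcube.
have ha : \forall n \near \oo, cube (a n).
  by exists 0%N => // k _; exact: (phi_word_cube cd).
have [p [_ pc]] := @cube_compact R d (a n @[n --> \oo]) _ ha.
exists p => m _.
have cl : closed (phiw (mkseq om m) @` cube).
  by apply: compact_closed; [exact: norm_hausdorff|exact: cylinder_compact].
apply: cl => B Bp; apply: pc => //.
exists m => // k /= mk; apply: (@mem_cylinderS om m (k - m)).
by rewrite subnKC//; exists midcube.
Qed.

Lemma coding_cube om : cube (pi om).
Proof. by have [x cx <-] := coding_mem om 0. Qed.

(** The cylinders shrink to a point. *)
Lemma coding_unique om x : (forall n, (phiw (mkseq om n) @` cube) x) ->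
  x = pi om.
Proof.
move=> h; apply/eqP; rewrite -subr_eq0; apply/eqP/enorm_eq0/eqP.
rewrite eq_le enorm_ge0 andbT.
have le n : enorm (x - pi om) <= d%:R * rho ^+ n.
  have [y cy <-] := h n; have [z cz <-] := coding_mem om n.
  apply: le_trans (phi_word_contr cd _ cy cz) _; rewrite size_mkseq mulrC.
  have /andP[r0 _] := cd_rho cd.
  by rewrite ler_pM2r ?exprn_gt0//; exact: enorm_cube_le.
have c0 : (fun n => d%:R * rho ^+ n) @ \oo --> (d%:R * 0 : R).
  apply: cvgMl_tmp; apply: cvg_expr.
  by have /andP[r0 r1] := cd_rho cd; rewrite ger0_norm// ltW.
rewrite mulr0 in c0; rewrite -(cvg_lim _ c0)//.
by apply: limr_ge; [apply/cvg_ex; exists 0|exact: nearW].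
Qed.

Lemma coding_shiftn n om : pi om = phiw (mkseq om n) (pi (shiftn n om)).
Proof.
apply/esym/coding_unique => m; apply: (@mem_cylinderS om m n).
rewrite addnC mkseqD; have [y cy <-] := coding_mem (shiftn n om) m.
by exists y => //; rewrite phi_word_cat.
Qed.

Lemma coding_catw u om : pi (catw u om) = phiw u (pi om).
Proof. by rewrite (coding_shiftn (size u)) mkseq_catw shiftn_catw. Qed.

Lemma phi_word_inv_coding n om :
  phi_word_inv phi (mkseq om n) (pi om) = pi (shiftn n om).
Proof.
rewrite /phi_word_inv; have : exists y, [set y | cube y /\
    phiw (mkseq om n) y = pi om] y.
  by exists (pi (shiftn n om)); split; [exact: coding_cube|rewrite -coding_shiftn].
move=> /getPex [cy e]; apply: (phi_word_inj cd cy (coding_cube _)) (etrans e _).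
exact: coding_shiftn.
Qed.

Lemma shift_map_coding om : limit_set_uniq phi (pi om) ->
  shift_map phi (pi om) = pi (shiftn 1 om).
Proof.
move=> [_ [om0 [_ uniq]]]; rewrite /shift_map.
have : exists y, [set y | exists2 w, pi w = pi om & y = pi (fun n => w n.+1)] y.
  by exists (pi (shiftn 1 om)), om.
move=> /getPex [w e ->]; congr pi.
by rewrite -(uniq w e) -(uniq om).
Qed.

(** Two codings of the shifted point would give two codings of the point. *)
Lemma limit_set_uniq_shiftn n om : limit_set_uniq phi (pi om) ->
  limit_set_uniq phi (pi (shiftn n om)).
Proof.
move=> [_ [om0 [e0 uniq]]]; split; first by exists (shiftn n om).
exists (shiftn n om); split => // w we.
have := uniq (catw (mkseq om n) w); rewrite coding_catw we -coding_shiftn.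
move=> /(_ erefl) e; have := shiftn_catw (mkseq om n) w.
by rewrite size_mkseq => <-; rewrite -e (uniq om erefl).
Qed.

Lemma iter_shift_map_coding n om : limit_set_uniq phi (pi om) ->
  iter n (shift_map phi) (pi om) = pi (shiftn n om).
Proof.
move=> h; elim: n => //= n ->; rewrite shift_map_coding; last first.
  exact: limit_set_uniq_shiftn.
by rewrite shiftnD addn1.
Qed.

End Coding.

Section BirkhoffSums.
Context {R : realType} {d : nat} {L : countType}.
Hypothesis d_gt0 : (0 < d)%N.
Local Notation E := 'rV[R]_d.
Variable phi : L -> E -> E.
Local Notation phiw := (phi_word phi).
Variables (rho K : R) (V : set E).
Hypothesis cd : conformal_data phi rho K V.
Variable f : E -> R.
Hypothesis f_gt0 : forall x, cube x -> 0 < f x.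
Hypothesis f_tempered : tempered_distortion phi f.
Implicit Types (x y z : E) (u v : seq L) (om : nat -> L).

Local Notation pi := (coding phi).

Definition orbit_sum n om : R := \sum_(k < n) f (pi (shiftn k om)).

Lemma orbit_sumD m n om :
  orbit_sum (m + n) om = orbit_sum m om + orbit_sum n (shiftn m om).
Proof.
rewrite /orbit_sum big_split_ord/=; congr (_ + _).
by apply: eq_bigr => i _; rewrite shiftnD.
Qed.

Lemma orbit_sum_ge0 n om : 0 <= orbit_sum n om.
Proof.
by apply: sumr_ge0 => i _; apply/ltW/f_gt0; exact: (coding_cube d_gt0 cd).
Qed.

Lemma word_sum_coding n om : (0 < n)%N ->
  word_sum phi f (mkseq om n) (pi om) = orbit_sum n om.
Proof.
case: n => // n _; rewrite /word_sum /orbit_sum big_ord_recl; congr (_ + _).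
rewrite size_mkseq big_add1 big_mkord; apply: eq_bigr => i _.
rewrite -(phi_word_inv_coding d_gt0 cd) -map_take take_iota (minn_idPl _)//.
by rewrite ltnS ltnW.
Qed.

Lemma birkhoff_sum_coding n om : limit_set_uniq phi (pi om) ->
  birkhoff_sum phi f n (pi om) = orbit_sum n om.
Proof.
move=> h; rewrite /birkhoff_sum big_mkord; apply: eq_bigr => k _.
by rewrite (iter_shift_map_coding d_gt0 cd).
Qed.

Definition cylvar n : R := fine (cyl_variation phi f n).

Let var_mem n om om' : mkseq om n = mkseq om' n ->
  ((`|f (pi om) - f (pi om')|)%:E <= cyl_variation phi f n)%E.
Proof.
move=> e; apply: ereal_sup_ubound; exists (pi om, pi om') => //=.
exists (Tuple (introT eqP (size_mkseq om n))).
by split; [exists om|exists om'] => //=; rewrite size_mkseq -?e.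
Qed.

Lemma cyl_variation_ge0 n (om : nat -> L) : (0 <= cyl_variation phi f n)%E.
Proof.
by have := @var_mem n om om erefl; rewrite subrr normr0.
Qed.

Lemma cyl_variation_fin n (om : nat -> L) : (0 < n)%N ->
  cyl_variation phi f n \is a fin_num.
Proof.
move=> n0; rewrite ge0_fin_numE ?(cyl_variation_ge0 _ om)//.
apply: le_lt_trans f_tempered.1; apply: ge_ereal_sup.
move=> _ [[x y] [w [/= [om1 c1 e1] [om2 c2 e2]]] <-] /=.
rewrite -c1 -c2; apply: var_mem.
have : mkseq om1 n = mkseq om2 n by rewrite -(size_tuple w) e1 e2.
by case: (n) n0 => // m _ /= [e _]; rewrite /mkseq/= e.
Qed.

Lemma le_cylvar n om om' : (0 < n)%N -> mkseq om n = mkseq om' n ->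
  `|f (pi om) - f (pi om')| <= cylvar n.
Proof.
move=> n0 e; rewrite -lee_fin /cylvar fineK ?(cyl_variation_fin om)//.
exact: var_mem.
Qed.

Lemma cylvar_ge0 n (om : nat -> L) : 0 <= cylvar n.
Proof. by apply: fine_ge0; exact: (cyl_variation_ge0 _ om). Qed.

Lemma cylvar_cvg0 : cylvar n @[n --> \oo] --> (0 : R).
Proof. by have := fine_cvg f_tempered.2; exact. Qed.

Definition cylvar_sum n : R := \sum_(k < n) cylvar k.+1.

Lemma cylvar_sum_ge0 n (om : nat -> L) : 0 <= cylvar_sum n.
Proof. by apply: sumr_ge0 => i _; exact: (cylvar_ge0 _ om). Qed.

(** Hence changing the sample point in a cylinder of level [n] changes Birkhoff
    sums by [o(n)]. *)
Lemma cylvar_sum_mean : (cylvar_sum n / n%:R) @[n --> \oo] --> (0 : R).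
Proof.
have h : (cylvar n.+1) @[n --> \oo] --> (0 : R).
  by have := cylvar_cvg0; rewrite -cvg_shiftS.
have := cesaro h; rewrite -(cvg_shiftS (fun n => cylvar_sum n / n%:R)).
apply: cvg_trans; apply: near_eq_cvg; apply: nearW => n.
by rewrite /arithmetic_mean/= mulrC /cylvar_sum /series/= big_mkord.
Qed.

(** After [k] shifts the two codings still share [n - k] letters. *)
Lemma orbit_sum_distortion n om om' : mkseq om n = mkseq om' n ->
  orbit_sum n om <= orbit_sum n om' + cylvar_sum n.
Proof.
elim: n om om' => [|n IH] om om' e.
  by rewrite /orbit_sum /cylvar_sum !big_ord0 addr0.
rewrite -add1n !orbit_sumD /cylvar_sum big_ord_recr/= -/(cylvar_sum n).
have e1 := @mkseq_shiftn _ om om' 1 n e.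
have := IH _ _ e1; have := @le_cylvar n.+1 om om' isT e.
rewrite /orbit_sum !big_ord1 !shiftn0 ler_norml; lra.
Qed.

(** An infimum, rather than the value at a sample point, makes the sums
    superadditive under concatenation. *)
Definition low_sum u : R :=
  inf [set orbit_sum (size u) om | om in [set om | mkseq om (size u) = u]].

Let has_inf_low_sum (i0 : L) u : has_inf
  [set orbit_sum (size u) om | om in [set om | mkseq om (size u) = u]].
Proof.
split; last by exists 0 => _ [om _ <-]; exact: orbit_sum_ge0.
pose om := catw u (fun=> i0); exists (orbit_sum (size u) om).
by exists om => //=; exact: mkseq_catw.
Qed.

Lemma low_sum_le n om : low_sum (mkseq om n) <= orbit_sum n om.
Proof.
apply: (ge_inf (has_inf_low_sum (om 0%N) _).2).
by exists om => /=; rewrite size_mkseq.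
Qed.

Lemma low_sum_glb u (b : R) (om : nat -> L) :
  (forall om, mkseq om (size u) = u -> b <= orbit_sum (size u) om) ->
  b <= low_sum u.
Proof.
move=> h; apply: lb_le_inf; first by have [] := has_inf_low_sum (om 0%N) u.
by move=> _ [om' e <-]; exact: h.
Qed.

Lemma low_sum_ge0 u (om : nat -> L) : 0 <= low_sum u.
Proof. by apply: (low_sum_glb om) => om' _; exact: orbit_sum_ge0. Qed.

Lemma orbit_sum_le_low n om :
  orbit_sum n om <= low_sum (mkseq om n) + cylvar_sum n.
Proof.
rewrite -lerBlDr; apply: (low_sum_glb om) => om'; rewrite size_mkseq => e.
by rewrite lerBlDr; apply: orbit_sum_distortion.
Qed.

Lemma low_sum_cat u v (om : nat -> L) :
  low_sum u + low_sum v <= low_sum (u ++ v).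
Proof.
apply: (low_sum_glb om) => om'; rewrite size_cat mkseqD orbit_sumD => e.
have /andP[/eqP e1 /eqP e2] : (mkseq om' (size u) == u) &&
    (mkseq (shiftn (size u) om') (size v) == v).
  by rewrite -eqseq_cat ?size_mkseq// e.
have h1 := low_sum_le (size u) om'; rewrite e1 in h1.
have h2 := low_sum_le (size v) (shiftn (size u) om'); rewrite e2 in h2.
exact: lerD.
Qed.

End BirkhoffSums.

(** * Mass on a tree, and packing *)

Section TreeAvoidance.
Context {R : realType} {A : finType}.
Variable m : seq A -> R.
Hypothesis m_ge0 : forall u, 0 <= m u.
Hypothesis m_nil : m [::] = 1.
Hypothesis m_add : forall u, \sum_a m (rcons u a) = m u.

(** As long as the subtrees hanging below [u] have total mass less than [m u], the
    same holds for one of the children of [u]; following such children from the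
    root gives the path. *)
Lemma path_avoiding (U : nat -> seq (seq A)) :
  (\sum_(0 <= k <oo) (\sum_(v <- U k) m v)%:E < 1)%E ->
  exists om, (forall n, 0 < m (mkseq om n)) /\
    forall k n, mkseq om n \notin U k.
Proof.
move=> U1.
pose b u k : R := \sum_(v <- U k | prefix u v) m v.
pose a u : \bar R := (\sum_(0 <= k <oo) (b u k)%:E)%E.
have b0 u k : 0 <= b u k by apply: sumr_ge0.
have split_child u k : \sum_x b (rcons u x) k <= b u k.
  rewrite /b; under eq_bigr do rewrite big_mkcond.
  rewrite exchange_big/= [leRHS]big_mkcond/=; apply: ler_sum => v _.
  have [/prefixP[v' ->]|nuv] := boolP (prefix u v); last first.
    rewrite big1// => x _; case: ifP => // /prefixP[w e].
    by rewrite e -cats1 -catA prefix_prefix in nuv.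
  case: v' => [|y v'].
    rewrite big1// => x _; case: ifP => // /size_prefix.
    by rewrite cats0 size_rcons ltnn.
  rewrite (bigD1 y)//= big1 ?addr0; first by case: ifP.
  by move=> x /negPf xy; rewrite -cats1 prefix_catr// eqxx prefix_cons xy.
have a_ge u k : ((b u k)%:E <= a u)%E.
  rewrite /a (nneseries_split 0 k.+1)//; last by move=> j _; rewrite lee_fin.
  rewrite big_nat_recr//= add0n; apply: le_trans (leeDl _ _); last first.
    by apply: nneseries_ge0 => j _ _; rewrite lee_fin.
  by rewrite leeDr// sume_ge0// => j _; rewrite lee_fin.
have a_nil : (a [::] < (m [::])%:E)%E.
  rewrite m_nil; apply: le_lt_trans U1; rewrite /a /b.
  by under eq_eseriesr do under eq_bigl do rewrite prefix0s.
have step u : (a u < (m u)%:E)%E ->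
    exists x, (a (rcons u x) < (m (rcons u x))%:E)%E.
  apply: contraPP => nx; apply/negP; rewrite -leNgt -(m_add u) -sumEFin.
  apply: le_trans (_ : (\sum_x a (rcons u x) <= _)%E).
    apply: lee_sum => x _; rewrite leNgt; apply/negP => h; apply: nx.
    by exists x.
  rewrite /a -nneseries_sum; last by move=> x k _; rewrite lee_fin.
  apply: lee_nneseries => k _; first by move=> _; apply: sume_ge0 => x _; rewrite lee_fin.
  by rewrite sumEFin lee_fin.
have [x0 _] := step _ a_nil.
pose next u := odflt x0 [pick x | (a (rcons u x) < (m (rcons u x))%:E)%E].
have nextP u : (a u < (m u)%:E)%E -> (a (rcons u (next u)) < (m (rcons u (next u)))%:E)%E.
  move=> /step[x ax]; rewrite /next; case: pickP => [y //|/(_ x)].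
  by rewrite ax.
pose pref n := iter n (fun u => rcons u (next u)) [::].
pose om n := next (pref n).
have omE n : mkseq om n = pref n.
  by elim: n => // n IH; rewrite mkseqS IH.
have ap n : (a (mkseq om n) < (m (mkseq om n))%:E)%E.
  by rewrite omE; elim: n => // n IH; exact: nextP.
exists om; split.
  move=> n; rewrite -lte_fin; apply: le_lt_trans (ap n).
  by apply: nneseries_ge0 => j _ _; rewrite lee_fin.
move=> k n; apply/negP => h.
have mb : m (mkseq om n) <= b (mkseq om n) k.
  rewrite /b big_mkcond (big_rem _ h)/= prefix_refl lerDl.
  by apply: sumr_ge0 => v _; case: ifP.
have : ((m (mkseq om n))%:E <= a (mkseq om n))%E.
  by apply: le_trans (a_ge _ k); rewrite lee_fin.
by rewrite leNgt ap.
Qed.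

End TreeAvoidance.

Section Packing.
Context {R : realType} {d : nat}.
Hypothesis d_gt0 : (0 < d)%N.
Local Notation E := 'rV[R]_d.

(** A grid whose cells are smaller than the separation has at most one point in
    each cell, and the number of cells needed only depends on the dimension and
    on the ratio of the two distances. *)
Lemma packing (B : R) : 0 <= B -> exists M : nat,
  forall (T : eqType) (S : set T) (z : T -> E) (r : R), 0 < r ->
    (forall v v', S v -> S v' -> enorm (z v - z v') <= B * r) ->
    (forall v v', S v -> S v' -> v != v' -> r <= enorm (z v - z v')) ->
  exists2 l : seq T, (size l <= M)%N & forall v, S v <-> v \in l.
Proof.
move=> B0.
have dp : 0 < d%:R :> R by rewrite ltr0n.
pose N := (Num.truncn (4 * d%:R * B)).+1.
exists #|{ffun 'I_d -> 'I_N}| => T S z r r0 zB zr.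
have [[v0 Sv0]|S0] := pselect (exists v, S v); last first.
  by exists [::] => // v; split => // Sv; case: S0; exists v.
(* two points in a cell of side [w] are at distance at most [d * w < r] *)
pose w := r / (2 * d%:R).
have w0 : 0 < w by rewrite divr_gt0 ?mulr_gt0.
pose c v i := ((z v - z v0) 0 i + B * r) / w.
have c0 v i : S v -> 0 <= c v i <= 4 * d%:R * B.
  move=> Sv; have h : `|(z v - z v0) 0 i| <= B * r.
    by apply: le_trans (coord_le_enorm _ _) (zB _ _ Sv Sv0).
  move: h; rewrite ler_norml => /andP[h1 h2]; apply/andP; split.
    by apply: divr_ge0; [lra|exact: ltW].
  have dn0 : d%:R != 0 :> R by rewrite gt_eqF.
  have -> : 4 * d%:R * B = (B * r + B * r) / w.
    by rewrite /w; field; rewrite dn0 gt_eqF.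
  by rewrite ler_pM2r ?invr_gt0// lerD2r.
pose cell v : {ffun 'I_d -> 'I_N} := [ffun i => inord (Num.truncn (c v i))].
have inj v v' : S v -> S v' -> cell v = cell v' -> v = v'.
  move=> Sv Sv' e; apply/eqP; apply: contraT => vv'.
  suff : enorm (z v - z v') < r by rewrite ltNge zr.
  apply: le_lt_trans (_ : d%:R * w < _); last first.
    have -> : d%:R * w = r / 2 by rewrite /w; field; rewrite gt_eqF.
    by rewrite ltr_pdivrMr// ltr_pMr// ltr1n.
  apply: enorm_le_bound => i.
  have lt u : S u -> (Num.truncn (c u i) < N)%N.
    move=> Su; rewrite ltnS; apply: le_truncn; by case/andP: (c0 u i Su).
  have et : Num.truncn (c v i) = Num.truncn (c v' i).
    have := congr1 (fun g : {ffun 'I_d -> 'I_N} => val (g i)) e.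
    by rewrite !ffunE /= !inordK ?lt.
  have /andP[cv _] := c0 v i Sv; have /andP[cv' _] := c0 v' i Sv'.
  have /andP[l1 l2] := truncn_itv cv; have /andP[l3 l4] := truncn_itv cv'.
  rewrite et in l1 l2.
  have -> : (z v - z v') 0 i = (c v i - c v' i) * w.
    by rewrite /c -mulrBl mulfVK ?gt_eqF// !mxE; ring.
  have c1 : `|c v i - c v' i| <= 1.
    by rewrite ler_norml; rewrite -natr1 in l2 l4; apply/andP; split; lra.
  by rewrite normrM (gtr0_norm w0) -[leRHS]mul1r ler_wpM2r// ltW.
pose pk g : option T := if pselect (exists2 v, S v & cell v = g) is left h
  then Some (projT1 (cid2 h)) else None.
exists (pmap pk (enum {ffun 'I_d -> 'I_N})).
  by rewrite size_pmap (leq_trans (count_size _ _))// cardE.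
move=> v; rewrite mem_pmap; split.
  move=> Sv; apply/mapP; exists (cell v); first by rewrite mem_enum.
  rewrite /pk; case: pselect => [h|[]]; last by exists v.
  by case: cid2 => v' /= Sv' /inj ->.
move=> /mapP[g _]; rewrite /pk; case: pselect => // h [->].
by case: cid2.
Qed.

End Packing.

(** * Hausdorff measure and the mass distribution principle *)

Section HausdorffTools.
Context {R : realType} {d : nat}.
Local Notation E := 'rV[R]_d.
Implicit Types (U A B : set E) (s t e : R).

Lemma le_ediam U x y : U x -> U y -> ((enorm (x - y))%:E <= ediam U)%E.
Proof. by move=> Ux Uy; apply: ereal_sup_ubound; exists (x, y). Qed.

Lemma ediam_le U (b : \bar R) :
  (forall x y, U x -> U y -> ((enorm (x - y))%:E <= b)%E) -> (ediam U <= b)%E.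
Proof. by move=> h; apply: ge_ereal_sup => _ [[x y] [/= Ux Uy] <-]; exact: h. Qed.

Lemma ediam_ge0 U x : U x -> (0 <= ediam U)%E.
Proof. by move=> Ux; have := le_ediam Ux Ux; rewrite subrr enorm0. Qed.

Lemma ediam_set0 : ediam (@set0 E) = -oo%E.
Proof. by apply/eqP; rewrite -leeNy_eq; apply: ediam_le. Qed.

Lemma diam_pow_ge0 s U : (0 <= diam_pow s U)%E.
Proof. by rewrite /diam_pow; case: ifP => // _; exact: poweR_ge0. Qed.

Lemma diam_pow_set0 s : diam_pow s (@set0 E) = 0%E.
Proof. by rewrite /diam_pow eqxx. Qed.

(** The extra [e] leaves room for a positive radius when [U] has diameter 0. *)
Lemma diam_pow_radius s e U : 0 < s -> 0 < e -> (diam_pow s U + e%:E < 1)%E ->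
  exists r, [/\ 0 < r < 1, (ediam U <= r%:E)%E &
    ((r `^ s)%:E <= diam_pow s U + e%:E)%E].
Proof.
move=> s0 e0 h.
suff [D [D0 UD DE]] : exists D, [/\ 0 <= D, (ediam U <= D%:E)%E &
    diam_pow s U = (D `^ s)%:E].
  rewrite DE -EFinD lte_fin in h; rewrite DE -EFinD.
  have p0 : 0 < D `^ s + e by rewrite ltr_wpDl ?powR_ge0.
  have rs : ((D `^ s + e) `^ s^-1) `^ s = D `^ s + e.
    by rewrite -powRrM mulVf ?gt_eqF// powRr1// ltW.
  exists ((D `^ s + e) `^ s^-1); split; last by rewrite rs.
    rewrite powR_gt0//=; have [|r1] := ltP; first by [].
    have := @ge0_ler_powR _ s (ltW s0) 1 _ _ _ r1.
    by rewrite powR1 rs !nnegrE ler01 powR_ge0 => /(_ isT isT); rewrite leNgt h.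
  apply: le_trans UD _; rewrite lee_fin.
  rewrite -[leLHS](powRr1 D0) -(mulfV (lt0r_neq0 s0)) powRrM.
  apply: ge0_ler_powR; rewrite ?nnegrE ?invr_ge0 ?powR_ge0 ?(ltW s0) ?(ltW p0)//.
  by rewrite lerDl ltW.
have [U0|U0] := eqVneq U set0.
  by exists 0; rewrite U0 diam_pow_set0 ediam_set0 powR0 ?gt_eqF//; split; rewrite ?leNye.
have /set0P[x Ux] := U0.
move: h; rewrite /diam_pow (negPf U0) => h.
have Dfin : ediam U \is a fin_num.
  rewrite ge0_fin_numE ?(ediam_ge0 Ux)//.
  apply: (@lty_poweRy _ _ s); first by rewrite gt_eqF.
  apply: le_lt_trans (lt_trans h (ltry 1)); first by rewrite leeDl ?lee_fin ?ltW.
exists (fine (ediam U)); rewrite fine_ge0 ?(ediam_ge0 Ux)//.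
by rewrite -poweR_EFin !fineK.
Qed.

Lemma hausdorff_pre_ge0 s (delta : R) A : (0 <= hausdorff_pre s delta A)%E.
Proof.
apply: le_ereal_inf_tmp => _ [U _ <-]; apply: nneseries_ge0 => k _ _.
exact: diam_pow_ge0.
Qed.

Lemma hausdorff_dim_ge0 A : (0 <= hausdorff_dim A)%E.
Proof. by apply: le_ereal_inf_tmp => _ [s [s0 _] <-]; rewrite lee_fin. Qed.

(** For sets of diameter at most 1, raising the exponent lowers the sums. *)
Lemma hausdorff_dim_lt_cover A t : (hausdorff_dim A < t%:E)%E ->
  forall e, 0 < e -> exists2 U : nat -> set E, A `<=` \bigcup_k U k &
    (\sum_(0 <= k <oo) diam_pow t (U k) <= e%:E)%E.
Proof.
move=> /ereal_inf_lt[_ [s [s0 Hs] <-]]; rewrite lte_fin => st e e0.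
have : (hausdorff_pre s 1 A < e%:E)%E.
  apply: le_lt_trans (_ : 0 < _)%E; last by rewrite lte_fin.
  by rewrite -Hs; apply: ereal_sup_ubound; exists 1 => //=.
move=> /ereal_inf_lt[_ [U [AU Ud] <-]] h; exists U => //.
apply: le_trans (ltW h); apply: lee_nneseries => k _.
  by move=> _; exact: diam_pow_ge0.
rewrite /diam_pow; case: ifPn => // /set0P[x Ux].
have := Ud k; have := ediam_ge0 Ux; case: (ediam (U k)) => // r.
rewrite !poweR_EFin !lee_fin => r0 r1.
have [->|rn0] := eqVneq r 0.
  rewrite powR0; first exact: powR_ge0.
  by rewrite gt_eqF// (le_lt_trans s0).
by apply: ger_powR; rewrite ?(ltW st)// lt0r rn0 r0.
Qed.

Lemma cover_union A B t e (U U' : nat -> set E) :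
  A `<=` \bigcup_k U k -> B `<=` \bigcup_k U' k -> 0 <= e ->
  (\sum_(0 <= k <oo) diam_pow t (U k) <= e%:E)%E ->
  (\sum_(0 <= k <oo) diam_pow t (U' k) <= e%:E)%E ->
  exists2 W : nat -> set E, A `|` B `<=` \bigcup_k W k &
    (\sum_(0 <= k <oo) diam_pow t (W k) <= (e + e)%:E)%E.
Proof.
move=> AU BU e0 Ue Ue'.
pose W k := if odd k then U' k./2 else U k./2.
exists W.
  move=> x [/AU[k _ Ux]|/BU[k _ Ux]].
    by exists k.*2 => //; rewrite /W odd_double doubleK.
  by exists k.*2.+1 => //; rewrite /W /= odd_double /= uphalf_double.
apply: lime_le; first by apply: is_cvg_nneseries => k _ _; exact: diam_pow_ge0.
apply: nearW => n.
have dd k : (0 <= k <= k.*2)%N by rewrite -addnn leq_addr.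
apply: le_trans (_ : (\sum_(0 <= k < n.*2) diam_pow t (W k) <= _)%E).
  rewrite -addnn (big_cat_nat _ (leq_addr n n))//= leeDl//.
  by apply: sume_ge0 => k _; exact: diam_pow_ge0.
have -> : (\sum_(0 <= k < n.*2) diam_pow t (W k) =
    \sum_(0 <= k < n) diam_pow t (U k) + \sum_(0 <= k < n) diam_pow t (U' k))%E.
  elim: n => [|n IH]; first by rewrite !big_geq// adde0.
  rewrite doubleS !big_nat_recr//= IH.
  have -> : W n.*2 = U n by rewrite /W odd_double doubleK.
  have -> : W n.*2.+1 = U' n by rewrite /W /= odd_double /= uphalf_double.
  by rewrite addeACA addeA.
rewrite EFinD; apply: leeD.
  by apply: le_trans Ue; apply: nneseries_lim_ge => k _ _; exact: diam_pow_ge0.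
by apply: le_trans Ue'; apply: nneseries_lim_ge => k _ _; exact: diam_pow_ge0.
Qed.

Lemma hausdorff_dim_le A s : 0 <= s ->
  (forall delta e, 0 < delta -> 0 < e -> exists U : nat -> set E,
    [/\ A `<=` \bigcup_k U k, forall k, (ediam (U k) <= delta%:E)%E &
    (\sum_(0 <= k <oo) diam_pow s (U k) <= e%:E)%E]) ->
  (hausdorff_dim A <= s%:E)%E.
Proof.
move=> s0 h; apply: ereal_inf_lbound; exists s => //; split => //.
apply/eqP; rewrite eq_le; apply/andP; split; last first.
  apply: le_trans (hausdorff_pre_ge0 s 1 A) _.
  by apply: ereal_sup_ubound; exists 1 => //=.
apply: ge_ereal_sup => _ [delta /= d0 <-].
apply/lee_addgt0Pr => e e0; rewrite add0e.
have [U [AU Ud Ue]] := h delta e d0 e0.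
by apply: le_trans Ue; apply: ereal_inf_lbound; exists U.
Qed.

End HausdorffTools.

Section MassDistribution.
Context {R : realType} {d : nat} {A : finType}.
Hypothesis d_gt0 : (0 < d)%N.
Local Notation E := 'rV[R]_d.
Variables (m Q : seq A -> R) (P : (nat -> A) -> E) (z : seq A -> E).
Variables (s C c b D theta : R).
Hypothesis s_gt0 : 0 < s.
Hypothesis C_gt0 : 0 < C.
Hypothesis c_gt0 : 0 < c.
Hypothesis b_gt0 : 0 < b.
Hypothesis D_ge0 : 0 <= D.
Hypothesis theta01 : 0 < theta < 1.
Hypothesis m_ge0 : forall u, 0 <= m u.
Hypothesis m_nil : m [::] = 1.
Hypothesis m_add : forall u, \sum_a m (rcons u a) = m u.
Hypothesis m_le : forall u, m u <= C * Q u `^ s.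
Hypothesis Q_gt0 : forall u, 0 < Q u.
Hypothesis Q_nil : Q [::] = 1.
Hypothesis Q_le : forall u, Q u <= theta ^+ size u.
Hypothesis Q_cat : forall u v, Q (u ++ v) <= Q u.
Hypothesis Q_rcons : forall u a, c * Q u <= Q (rcons u a).
Hypothesis P_near : forall om n,
  enorm (P om - z (mkseq om n)) <= D * Q (mkseq om n).
Hypothesis z_sep : forall u v, ~~ prefix u v -> ~~ prefix v u ->
  b * Q u <= enorm (z v - z u).

(** The words at which a path first reaches scale [r]. *)
Definition cut_word (r : R) (v : seq A) :=
  Q v <= r /\ exists u a, v = rcons u a /\ r < Q u.

Lemma cut_word_prefix r v v' : cut_word r v -> cut_word r v' -> v != v' ->
  ~~ prefix v v'.
Proof.
move=> [Qv _] [_ [u [a [-> ru]]]] vv'; apply/negP => /prefixP[w].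
case/lastP: w vv' => [|w x] vv'; first by rewrite cats0 => e; rewrite e eqxx in vv'.
rewrite -rcons_cat => /rcons_inj[e _].
by rewrite e in ru; have := lt_le_trans ru (Q_cat v w); rewrite ltNge Qv.
Qed.

Lemma cut_word_exists r om : 0 < r < 1 -> exists n, cut_word r (mkseq om n).
Proof.
move=> /andP[r0 r1].
have ex : exists n, Q (mkseq om n) <= r.
  have /andP[th0 th1] := theta01.
  have : theta ^+ i @[i --> \oo] --> (0 : R) by apply: cvg_expr; rewrite gtr0_norm.
  move=> /cvgr0Pnorm_lt/(_ _ r0) [N _ /(_ N (leqnn N))].
  rewrite gtr0_norm ?exprn_gt0// => h; exists N.
  by apply: le_trans (Q_le _) _; rewrite size_mkseq ltW.
case: (ex_minnP ex) => [[|n] Qn mn].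
  by move: Qn; rewrite Q_nil leNgt r1.
exists n.+1; split => //; exists (mkseq om n), (om n); rewrite mkseqS; split => //.
by rewrite ltNge; apply/negP => /mn; rewrite ltnn.
Qed.

(** The cut words of the paths whose points lie in a set of diameter [r] have
    reference points [z] within [O(r)] of each other and separated by a multiple of
    [r], so there is a bounded number of them, each of mass [O(r `^ s)]. *)
Lemma mass_distribution : exists2 eps, 0 < eps &
  forall U : nat -> set E, (\sum_(0 <= k <oo) diam_pow s (U k) <= eps%:E)%E ->
  exists om, (forall n, 0 < m (mkseq om n)) /\ forall k, ~ U k (P om).
Proof.
have bc0 : 0 < b * c by rewrite mulr_gt0.
have B0 : 0 <= (2 * D + 1) / (b * c).
  by apply: divr_ge0 (ltW bc0); rewrite addr_ge0// mulr_ge0.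
have [M hM] := @packing R d d_gt0 _ B0.
have MC0 : 0 < (M.+1)%:R * C by rewrite mulr_gt0.
(* the first bound keeps the radii below 1, the second keeps the total mass of
   the cut words, at most [M.+1 * C * 2 eps], below 1 *)
pose eps : R := Num.min 4^-1 (4 * ((M.+1)%:R * C))^-1.
have eps0 : 0 < eps by rewrite lt_min !invr_gt0 mulr_gt0 ?andbT.
exists eps => // U hU.
have U0 k : (0 <= diam_pow s (U k))%E by exact: diam_pow_ge0.
have Uk k : (diam_pow s (U k) <= eps%:E)%E.
  apply: le_trans hU; rewrite (nneseries_split 0 k.+1)// add0n big_nat_recr//=.
  apply: le_trans (leeDl _ _); last by apply: nneseries_ge0.
  by rewrite leeDr// sume_ge0.
pose e k := eps / (2 ^ k.+1)%:R.
have e0 k : 0 < e k by rewrite divr_gt0// ltr0n expn_gt0.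
have ee k : e k <= eps.
  by rewrite ler_pdivrMr ?ltr0n ?expn_gt0// ler_peMr ?(ltW eps0)// ler1n expn_gt0.
have rad k : exists r, [/\ 0 < r < 1, (ediam (U k) <= r%:E)%E &
    ((r `^ s)%:E <= diam_pow s (U k) + (e k)%:E)%E].
  apply: diam_pow_radius => //; apply: le_lt_trans (leeD (Uk k) (_ : (_ <= eps%:E)%E)) _.
    by rewrite lee_fin.
  rewrite -EFinD lte_fin.
  have : eps <= 4^-1 by rewrite ge_min lexx.
  lra.
have /choice[r hr] := rad.
pose S k := [set v : seq A | cut_word (r k) v /\
  exists om, mkseq om (size v) = v /\ U k (P om)].
have lists k : exists l : seq (seq A), (size l <= M)%N /\ forall v, S k v <-> v \in l.
  have [/andP[r0 r1] Ur _] := hr k.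
  have [|v v' [[Qv _] [om [ev Uom]]] [[Qv' _] [om' [ev' Uom']]]||l lM hl] :=
      hM _ (S k) z (b * c * r k); last by exists l.
  - exact: mulr_gt0.
  - rewrite mulrA mulfVK ?gt_eqF//.
    have h1 := P_near om (size v); rewrite ev in h1.
    have h2 := P_near om' (size v'); rewrite ev' in h2.
    have h3 : enorm (P om - P om') <= r k.
      by rewrite -lee_fin; apply: le_trans Ur; exact: le_ediam.
    have h4 := ler_enorm_dist (P om) (z v) (z v').
    have h5 := ler_enorm_dist (P om') (P om) (z v').
    rewrite (enormB (z v) (P om)) in h4.
    have : D * Q v <= D * r k by rewrite ler_wpM2l.
    have : D * Q v' <= D * r k by rewrite ler_wpM2l.
    lra.
  - move=> v v' [cv _] [cv' _] vv'.
    apply: le_trans (_ : b * Q v <= _); last first.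
      rewrite enormB; apply: z_sep; first exact: cut_word_prefix cv cv' vv'.
      by apply: cut_word_prefix cv' cv _; rewrite eq_sym.
    have [_ [u [a [-> ru]]]] := cv.
    rewrite -mulrA ler_pM2l//; apply: le_trans (Q_rcons u a).
    by rewrite ler_pM2l// ltW.
have /choice[l hl] := lists.
have [|om [om0 omU]] := path_avoiding m_ge0 m_nil m_add (U := l).
  apply: le_lt_trans (_ : (((M.+1)%:R * C)%:E *
      \sum_(0 <= k <oo) (diam_pow s (U k) + (e k)%:E) < 1)%E); last first.
    have : (\sum_(0 <= k <oo) (diam_pow s (U k) + (e k)%:E) <= (eps + eps)%:E)%E.
      rewrite EFinD; apply: le_trans (leeD hU (lexx _)).
      by apply: epsilon_trick => //; exact: ltW.
    move=> /(@lee_wpmul2l _ ((M.+1)%:R * C)%:E).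
    rewrite lee_fin ltW// => /(_ isT) /le_lt_trans; apply.
    rewrite -EFinM lte_fin.
    have : eps <= (4 * ((M.+1)%:R * C))^-1 by rewrite ge_min lexx orbT.
    rewrite -(ler_pM2l MC0) invfM mulrCA divff ?gt_eqF// mulr1.
    rewrite mulrDr; lra.
  rewrite -nneseriesZl; last by move=> k _; rewrite adde_ge0// lee_fin ltW.
  apply: lee_nneseries => k _; first by move=> _; rewrite lee_fin sumr_ge0.
  have [/andP[r0 r1] Ur rs] := hr k; have [lM hlk] := hl k.
  apply: le_trans (_ : (((M.+1)%:R * C) * (r k `^ s))%:E <= _)%E; last first.
    by rewrite EFinM lee_wpmul2l// lee_fin ltW.
  rewrite lee_fin; apply: le_trans (_ : (size (l k))%:R * (C * r k `^ s) <= _).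
    apply: le_trans (_ : \sum_(v <- l k) C * r k `^ s <= _); last first.
      by rewrite big_const_seq count_predT iter_addr_0 mulr_natl.
    rewrite big_seq [leRHS]big_seq; apply: ler_sum => v /hlk[[Qv _] _].
    apply: le_trans (m_le v) _; rewrite ler_pM2l//.
    by apply: ge0_ler_powR; rewrite ?nnegrE ?(ltW s_gt0) ?(ltW r0) ?(ltW (Q_gt0 v)).
  rewrite -mulrA ler_wpM2r ?mulr_ge0 ?powR_ge0 ?(ltW C_gt0)// ler_nat.
  exact: leqW.
exists om; split => // k UP.
have [/andP[r0 r1] Ur rs] := hr k; have [lM hlk] := hl k.
have [|n cn] := @cut_word_exists (r k) om; first by rewrite r0.
have := omU k n; apply/negP; rewrite negbK; apply/hlk; split => //.
by exists om; rewrite size_mkseq.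
Qed.

End MassDistribution.

(** * A mass carried by recurrent paths *)

Section RecurrentTree.
Context {R : realType} {A : finType}.
Variables (Q : seq A -> R) (G p : A -> R) (s K C1 c eta theta : R).
Hypothesis s_gt0 : 0 < s.
Hypothesis K_gt0 : 0 < K.
Hypothesis C1_ge1 : 1 <= C1.
Hypothesis c_gt0 : 0 < c.
Hypothesis eta01 : 0 < eta < 1.
Hypothesis theta01 : 0 < theta < 1.
Hypothesis Q_gt0 : forall u, 0 < Q u.
Hypothesis Q_nil : Q [::] = 1.
Hypothesis Q_cat : forall u v, Q u * Q v <= K * Q (u ++ v).
Hypothesis Q_le : forall u, Q u <= theta ^+ size u.
Hypothesis Q_ge : forall a, c <= Q [:: a].
Hypothesis G_ge0 : forall a, 0 <= G a.
Hypothesis p_gt0 : forall a, 0 < p a.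
Hypothesis p_sum : \sum_a p a = 1.
Hypothesis p_le : forall a, p a <= eta * (Q [:: a] / K * expR (- G a)) `^ s.
Implicit Types (u v : seq A) (om : nat -> A).

Definition cost u : R := \sum_(a <- u) G a.

(** Built along the reversal of a word: its mass and, when the next symbol is
    forced, the time [n] at which forcing began.  While [Some n] is current the
    word repeats its own beginning from position [n] on; this stops once the
    repeated part is long enough for a return at time [n]. *)
Fixpoint tree_state (v : seq A) : R * option nat :=
  if v is a :: v' then
    let u' := rev v' in let u := rcons u' a in
    let: (m, t) := tree_state v' in
    if t is Some n then
      (m * (a == nth a u' (size u' - n))%:R,
       if C1 * Q (take (size u - n) u) < expR (- cost (take n u)) then None
       else Some n)
    else (m * p a,
      if m * p a <= (Q u * expR (- cost u)) `^ s then Some (size u) else None)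
  else (1, None).

Definition mass u : R := (tree_state (rev u)).1.
Definition phase u : option nat := (tree_state (rev u)).2.

Lemma mass_nil : mass [::] = 1. Proof. by []. Qed.

Lemma mass_rcons u a : mass (rcons u a) = mass u *
  (if phase u is Some n then (a == nth a u (size u - n))%:R else p a).
Proof.
rewrite /mass /phase rev_rcons /= revK.
by case: (tree_state (rev u)) => m [n|].
Qed.

Lemma phase_rcons u a : phase (rcons u a) =
  if phase u is Some n then
    if C1 * Q (take ((size u).+1 - n) (rcons u a)) <
       expR (- cost (take n (rcons u a))) then None else Some n
  else if mass (rcons u a) <= (Q (rcons u a) * expR (- cost (rcons u a))) `^ s
    then Some (size u).+1 else None.
Proof.
rewrite /mass /phase rev_rcons /= revK size_rcons.
by case: (tree_state (rev u)) => m [n|].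
Qed.

Local Opaque mass phase.

Lemma phase_size u n : phase u = Some n -> (0 < n <= size u)%N.
Proof.
elim/last_ind: u n => // u a IH n; rewrite phase_rcons size_rcons.
case e: (phase u) => [k|].
  case: ifP => // _ [<-]; have /andP[k0 ku] := IH _ e.
  by rewrite k0 leqW.
by case: ifP => // _ [<-]; rewrite /= leqnn.
Qed.

Lemma mass_additive u : \sum_a mass (rcons u a) = mass u.
Proof.
under eq_bigr do rewrite mass_rcons; rewrite -mulr_sumr.
case e: (phase u) => [n|]; last by rewrite p_sum mulr1.
have /andP[n0 nu] := phase_size e.
case: u => [|b u] in e nu *; first by rewrite leqn0 in nu; rewrite (eqP nu) in n0.
set u0 := b :: u in e nu *.
rewrite (bigD1 (nth b u0 (size u0 - n)))//= big1 => [|a].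
  by rewrite (set_nth_default b) ?eqxx ?addr0 ?mulr1// ltn_subrL n0.
by rewrite (set_nth_default b) ?ltn_subrL ?n0// => /negPf ->.
Qed.

Lemma mass_ge0 u : 0 <= mass u.
Proof.
elim/last_ind: u => [|u a IH]; first exact: ler01.
by rewrite mass_rcons mulr_ge0//; case: (phase u) => [n|]; [exact: ler0n|exact: ltW].
Qed.

Lemma mass_rcons_gt0 u a : 0 < mass (rcons u a) -> 0 < mass u.
Proof.
move=> h; rewrite lt0r mass_ge0 andbT; apply: contraTneq h => h.
by rewrite mass_rcons h mul0r ltxx.
Qed.

Lemma mass_rcons_le u a : mass (rcons u a) <= mass u.
Proof.
rewrite -(mass_additive u) (bigD1 a)//= lerDl.
by apply: sumr_ge0 => b _; exact: mass_ge0.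
Qed.

Let wt u : R := Q u * expR (- cost u).

Let wt_gt0 u : 0 < wt u. Proof. by rewrite mulr_gt0 ?expR_gt0. Qed.

Lemma cost_ge0 u : 0 <= cost u.
Proof. by apply: sumr_ge0. Qed.

Lemma cost_rcons u a : cost (rcons u a) = cost u + G a.
Proof. by rewrite /cost -cats1 big_cat big_seq1. Qed.

(** A forced phase begins when the mass has dropped to its threshold, and lasts
    while the repeated part is still too long for a return. *)
Lemma phase_invariant u n : 0 < mass u -> phase u = Some n ->
  [/\ drop n u = take (size u - n) u, mass u <= wt (take n u) `^ s &
      expR (- cost (take n u)) <= C1 * Q (take (size u - n) u)].
Proof.
elim/last_ind: u n => // u a IH n mua; have mu := mass_rcons_gt0 mua.
rewrite phase_rcons size_rcons; case e: (phase u) => [k|]; last first.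
  case: ifP; last by move=> _ [].
  move=> h [<-].
  rewrite subnn take0.
  rewrite drop_oversize; last by rewrite size_rcons.
  rewrite take_oversize; last by rewrite size_rcons.
  split; [by []|exact: h|].
  rewrite Q_nil mulr1; apply: le_trans C1_ge1; rewrite -expR0 ler_expR.
  by rewrite oppr_le0 cost_ge0.
case: ifP => // /negbT; rewrite -leNgt => h [kn].
rewrite -{n}kn; have /andP[k0 ku] := phase_size e.
have [i1 i2 i3] := IH _ mu e.
have ea : a = nth a u (size u - k).
  move: mua; rewrite mass_rcons e; case: eqP => // _.
  by rewrite mulr0 ltxx.
have tk : take k (rcons u a) = take k u by rewrite -cats1 takel_cat.
split; [|by rewrite tk; exact: le_trans (mass_rcons_le _ _) i2|exact: h].
have lt : (size u - k < size u)%N by rewrite ltn_subrL k0 (leq_trans k0).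
rewrite drop_rcons// i1 subSn// -[in RHS]cats1 takel_cat//.
by rewrite (take_nth a)// -ea.
Qed.

Let cm : R := c / (C1 * K ^+ 2).

Definition mass_constant : R := Order.max 1 (cm `^ (- s)).

(** During a forced phase the word shrinks by at most what it already paid when
    the phase began, so the mass stays comparable to [Q u `^ s]. *)
Lemma mass_le u : mass u <= mass_constant * Q u `^ s.
Proof.
have C1_gt0 : 0 < C1 by apply: lt_le_trans C1_ge1.
have cm0 : 0 < cm by rewrite divr_gt0 ?mulr_gt0 ?exprn_gt0.
have C0 : 0 < mass_constant by rewrite lt_max ltr01.
elim/last_ind: u => [|u a IH].
  by rewrite mass_nil Q_nil powR1 mulr1 le_max lexx.
have [m0|mua] := leP (mass (rcons u a)) 0.
  by apply: le_trans m0 _; rewrite mulr_ge0 ?powR_ge0 ?ltW.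
have mu := mass_rcons_gt0 mua.
case e: (phase u) => [n|]; last first.
  rewrite mass_rcons e.
  apply: le_trans (ler_pM (mass_ge0 _) (ltW (p_gt0 a)) IH (p_le a)) _.
  have b0 : 0 < Q [:: a] / K * expR (- G a) by rewrite mulr_gt0 ?divr_gt0 ?expR_gt0.
  rewrite -(mulrA mass_constant) ler_pM2l// mulrCA -(powRM _ (ltW (Q_gt0 u)) (ltW b0)).
  have /andP[e0 e1] := eta01.
  apply: le_trans (_ : (Q u * (Q [:: a] / K * expR (- G a))) `^ s <= _).
    by rewrite ler_piMl ?powR_ge0 ?ltW.
  have e2 : Q u * (Q [:: a] / K * expR (- G a)) <= Q (rcons u a).
    rewrite mulrA; apply: le_trans (_ : Q u * (Q [:: a] / K) <= _).
      apply: ler_piMr; first exact/ltW/mulr_gt0/divr_gt0.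
      by rewrite -expR0 ler_expR oppr_le0.
    by rewrite mulrA ler_pdivrMr// (mulrC (Q (rcons _ _))) -cats1.
  by apply: ge0_ler_powR e2; rewrite ?nnegrE ?(ltW s_gt0) ?(ltW (Q_gt0 _))
    ?(ltW (mulr_gt0 (Q_gt0 _) b0)).
have [i1 i2 i3] := phase_invariant mu e.
have /andP[n0 nu] := phase_size e.
apply: le_trans (mass_rcons_le _ _) _; apply: le_trans i2 _.
have h : cm * wt (take n u) <= Q (rcons u a).
  have h1 := Q_cat (take n u) (rcons (drop n u) a).
  rewrite -rcons_cat cat_take_drop in h1.
  have h2 := Q_cat (drop n u) [:: a]; rewrite cats1 i1 in h2.
  have h3 := Q_ge a; rewrite i1 in h1.
  rewrite /wt /cm mulrAC ler_pdivrMr ?mulr_gt0 ?exprn_gt0//.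
  have q1 := Q_gt0 (take n u); have q2 := Q_gt0 (take (size u - n) u).
  set x := Q (take n u) in h1 q1 *; set y := Q (take (size u - n) u) in h2 i3 q2 *.
  set z := Q (rcons _ _) in h1 h2; set E := expR _ in i3 *.
  have : c * (x * E) <= c * (x * (C1 * y)).
    by rewrite !ler_pM2l.
  move=> /le_trans; apply.
  have : c * (x * (C1 * y)) <= C1 * x * (y * Q [:: a]).
    rewrite [leLHS](_ : _ = C1 * x * (y * c)); last by ring.
    by rewrite !ler_pM2l ?mulr_gt0.
  move=> /le_trans; apply.
  have : C1 * x * (y * Q [:: a]) <= C1 * x * (K * z).
    by rewrite ler_pM2l ?mulr_gt0.
  move=> /le_trans; apply.
  rewrite [leLHS](_ : _ = C1 * K * (x * z)); last by ring.
  rewrite [leRHS](_ : _ = C1 * K * (K * Q (rcons u a))); last by ring.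
  by rewrite ler_pM2l ?mulr_gt0.
apply: le_trans (_ : cm `^ (- s) * Q (rcons u a) `^ s <= _); last first.
  by rewrite ler_wpM2r ?powR_ge0// le_max lexx orbT.
rewrite powRN mulrC ler_pdivlMr ?powR_gt0// mulrC.
rewrite -(powRM _ (ltW cm0) (ltW (wt_gt0 _))).
by apply: ge0_ler_powR; rewrite ?nnegrE ?(ltW s_gt0) ?(ltW (Q_gt0 _))
  ?(ltW (mulr_gt0 cm0 (wt_gt0 _))).
Qed.

Section Path.
Variable om : nat -> A.
Hypothesis om_mass : forall n, 0 < mass (mkseq om n).

Let ph n := phase (mkseq om n).

Let phS n : phase (rcons (mkseq om n) (om n)) = ph n.+1.
Proof. by rewrite /ph mkseqS. Qed.

Let ph_Some n k : ph n = Some k -> ph n.+1 <> Some k -> ph n.+1 = None.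
Proof. by rewrite -phS phase_rcons /ph => ->; case: ifP. Qed.

Let ph_None n : ph n = None -> ph n.+1 <> None -> ph n.+1 = Some n.+1.
Proof. by rewrite -phS phase_rcons /ph => ->; case: ifP; rewrite // size_mkseq. Qed.

Let first_exit n (P : nat -> bool) : P n -> (exists2 j, (n <= j)%N & ~~ P j) ->
  exists2 j, (n <= j)%N & (forall i, (n <= i <= j)%N -> P i) /\ ~~ P j.+1.
Proof.
move=> Pn ex.
have ex' : exists j, (n <= j)%N && ~~ P j by have [j nj Pj] := ex; exists j; rewrite nj.
case: (ex_minnP ex') => [[|j]] /andP[nj Pj] mn.
  by move: nj Pj; rewrite leqn0 => /eqP n0; rewrite n0 in Pn; rewrite Pn.
move: nj; rewrite leq_eqVlt => /orP[/eqP nj|nj].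
  by rewrite -nj Pn in Pj.
exists j => //; split => // i /andP[ni ij]; apply: contraTT isT => Pi.
by have := mn i; rewrite ni Pi => /(_ isT); rewrite ltnNge ij.
Qed.

(** An endless repetition would contradict the decay of [Q]. *)
Let forced_ends n k : ph n = Some k -> exists2 j, (n <= j)%N & ph j != Some k.
Proof.
move=> e; apply: contrapT => nex.
have all j : (n <= j)%N -> ph j = Some k.
  by move=> nj; apply/eqP/negPn/negP => h; apply: nex; exists j.
have /andP[th0 th1] := theta01; have C10 : 0 < C1 by apply: lt_le_trans C1_ge1.
pose D := expR (- cost (mkseq om k)) / C1.
have D0 : 0 < D by rewrite divr_gt0 ?expR_gt0.
have le j : (n + k <= j)%N -> D <= theta ^+ (j - k).
  move=> nj; have e2 := all j (leq_trans (leq_addr _ _) nj).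
  have [_ _] := phase_invariant (om_mass j) e2.
  have /andP[_ kj] := phase_size e2; rewrite size_mkseq in kj *.
  have tk i : (i <= j)%N -> take i (mkseq om j) = mkseq om i.
    by move=> ij; rewrite -map_take take_iota (minn_idPl ij).
  rewrite !tk ?leq_subr// => h; rewrite /D ler_pdivrMr// mulrC.
  apply: le_trans h _; rewrite ler_pM2l//.
  by apply: le_trans (Q_le _) _; rewrite size_mkseq.
have : theta ^+ i @[i --> \oo] --> (0 : R) by apply: cvg_expr; rewrite gtr0_norm.
move=> /cvgr0Pnorm_lt/(_ _ D0) [N _ hN].
have kN : (n + k <= n + k + N + k)%N by rewrite -addnA leq_addr.
have := le _ kN; rewrite addnK.
have := hN (n + k + N)%N; rewrite /= leq_addl gtr0_norm ?exprn_gt0// => /(_ isT).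
by move=> /lt_le_trans h /h; rewrite ltxx.
Qed.

(** Each free symbol multiplies the ratio of the mass to its threshold by at most
    [eta], while a phase stays free only if this ratio exceeds 1. *)
Let free_ends n : ph n = None -> exists2 j, (n <= j)%N & ph j != None.
Proof.
move=> e; apply: contrapT => nex.
have all j : (n <= j)%N -> ph j = None.
  by move=> nj; apply/eqP/negPn/negP => h; apply: nex; exists j.
have /andP[e0 e1] := eta01.
have step j : (n <= j)%N -> mass (mkseq om j.+1) * wt (mkseq om j) `^ s <=
    eta * (mass (mkseq om j) * wt (mkseq om j.+1) `^ s).
  move=> nj; rewrite mkseqS mass_rcons -/(ph j) all//.
  set u := mkseq om j; set a := om j.
  rewrite mulrCA -mulrA (ler_pM2l (om_mass j)).
  apply: le_trans (_ : eta * (Q [:: a] / K * expR (- G a)) `^ s * wt u `^ s <= _).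
    by rewrite ler_wpM2r ?powR_ge0.
  have b0 : 0 < Q [:: a] / K * expR (- G a) by rewrite mulr_gt0 ?divr_gt0 ?expR_gt0.
  rewrite -mulrA ler_pM2l// -(powRM _ (ltW b0) (ltW (wt_gt0 u))).
  apply: ge0_ler_powR; rewrite ?nnegrE ?(ltW s_gt0) ?(ltW (wt_gt0 _))
    ?(ltW (mulr_gt0 b0 (wt_gt0 _)))//.
  rewrite /wt cost_rcons opprD expRD.
  rewrite [leLHS](_ : _ = Q u * Q [:: a] / K * (expR (- cost u) * expR (- G a))).
    rewrite ler_pM2r ?mulr_gt0 ?expR_gt0// ler_pdivrMr//.
    by rewrite (mulrC (Q (rcons _ _))) -cats1.
  by ring.
pose ra j := mass (mkseq om j) / wt (mkseq om j) `^ s.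
have ra_le k : ra (n + k)%N <= eta ^+ k * ra n.
  elim: k => [|k IH]; first by rewrite addn0 expr0 mul1r.
  rewrite exprS -mulrA addnS; apply: le_trans (_ : eta * ra (n + k)%N <= _).
    have swap (x y z t : R) : x * (y / z) * t = x * (y * t) / z.
      by rewrite !mulrA [LHS]mulrAC.
    rewrite /ra ler_pdivrMr ?powR_gt0// swap ler_pdivlMr ?powR_gt0//.
    exact: step (leq_addr _ _).
  by rewrite ler_pM2l.
have ra_gt k : 1 < ra (n + k).+1.
  have := all (n + k).+1 (leq_trans (leq_addr k n) (leqnSn _)).
  rewrite -phS phase_rcons /ph -/(ph _) all ?leq_addr// -mkseqS.
  case: ifP => // /negbT; rewrite -ltNge => h _.
  by rewrite /ra ltr_pdivlMr ?powR_gt0// mul1r.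
have rn0 : 0 < ra n by rewrite divr_gt0 ?powR_gt0.
have D0 : 0 < (ra n)^-1 by rewrite invr_gt0.
have : eta ^+ i @[i --> \oo] --> (0 : R) by apply: cvg_expr; rewrite gtr0_norm.
move=> /cvgr0Pnorm_lt/(_ _ D0) [N _ hN].
have := hN N.+1 (leqnSn N); rewrite gtr0_norm ?exprn_gt0//.
rewrite -[(_)^-1]mul1r ltr_pdivlMr// => h.
have := lt_trans (lt_le_trans (ra_gt N) _) h; rewrite -addnS => /(_ (ra_le _)).
by rewrite ltxx.
Qed.

(** Free and forced phases alternate for ever.  When the phase begun at time [n]
    ends, the path repeats itself from [n] on over a part that is short enough. *)
Lemma path_returns N : exists2 n, (N < n)%N & exists2 t,
  mkseq (shiftn n om) t = mkseq om t &
  C1 * Q (mkseq om t) < expR (- cost (mkseq om n)).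
Proof.
have [j Nj pj] : exists2 j, (N <= j)%N & ph j = None.
  case e: (ph N) => [k|]; last by exists N.
  have [|j Nj [allj nj]] := @first_exit N (fun j => ph j == Some k) _ (forced_ends e).
    exact/eqP.
  exists j.+1; first exact: leqW.
  apply: (@ph_Some j k); last exact/eqP.
  by apply/eqP/allj; rewrite Nj leqnn.
have [|i ji [alli ni]] := @first_exit j (fun j => ph j == None) _ (free_ends pj).
  exact/eqP.
have pi : ph i.+1 = Some i.+1.
  by apply: ph_None; [apply/eqP/alli; rewrite ji leqnn|exact/eqP].
have [|k ik [allk nk]] :=
    @first_exit i.+1 (fun j => ph j == Some i.+1) _ (forced_ends pi).
  exact/eqP.
have pk : ph k = Some i.+1 by apply/eqP/allk; rewrite ik leqnn.
exists i.+1; first by rewrite ltnS (leq_trans Nj).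
have tk m : (m <= k)%N -> take m (mkseq om k) = mkseq om m.
  by move=> ij; rewrite -map_take take_iota (minn_idPl ij).
have tk1 m : (m <= k.+1)%N -> take m (mkseq om k.+1) = mkseq om m.
  by move=> ij; rewrite -map_take take_iota (minn_idPl ij).
exists (k.+1 - i.+1)%N; last first.
  have := ph_Some pk (elimN eqP nk).
  rewrite -phS phase_rcons -/(ph k) pk size_mkseq -mkseqS.
  by rewrite !tk1 ?leq_subr ?leqW//; case: ifP.
(* the forced symbol at time [k] extends the agreement by one *)
have [i1 _ _] := phase_invariant (om_mass k) pk.
have e1 : mkseq (shiftn i.+1 om) (k - i.+1) = mkseq om (k - i.+1).
  rewrite size_mkseq tk ?leq_subr// in i1; rewrite -i1.
  rewrite -{2}(subnKC ik) mkseqD drop_size_cat ?size_mkseq//.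
rewrite subSn// !mkseqS e1; congr rcons.
have := om_mass k.+1; rewrite mkseqS mass_rcons -/(ph k) pk size_mkseq.
case: eqP => [e _|]; last by rewrite mulr0 ltxx.
rewrite /shiftn subnKC// e nth_mkseq//; by rewrite ltn_subrL (leq_trans _ ik).
Qed.

End Path.

End RecurrentTree.

(** * Countable sums and subadditive sequences *)

Section EsumTools.
Context {R : realType}.
Local Open Scope ereal_scope.

Lemma subset_esum (T : choiceType) (A B : set T) (a : T -> \bar R) :
  (forall i, 0 <= a i) -> A `<=` B ->
  \esum_(i in A) a i <= \esum_(i in B) a i.
Proof.
move=> a0 AB; rewrite (esumID A B)//; have -> : B `&` A = A by exact/setIidPr.
by rewrite leeDl// esum_ge0.
Qed.

Lemma esum_scale_le (T : choiceType) (A : set T) (x : \bar R) (a : T -> \bar R) :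
  0 <= x -> (forall i, 0 <= a i) ->
  \esum_(i in A) (x * a i) <= x * \esum_(i in A) a i.
Proof.
move=> x0 a0; apply: ge_ereal_sup => _ [X [finX XA] <-].
rewrite fsbig_finite//= -ge0_sume_distrr//.
apply: lee_wpmul2l => //; apply: esum_ge; exists X => //.
by rewrite fsbig_finite.
Qed.

Lemma esum_scale_ge (T : choiceType) (A : set T) (x : R) (a : T -> \bar R) :
  (0 < x)%R -> (forall i, 0 <= a i) ->
  x%:E * (\esum_(i in A) a i) <= \esum_(i in A) (x%:E * a i).
Proof.
move=> x0 a0; have xK (y : \bar R) : x%:E * (x^-1%:E * y) = y.
  by rewrite muleA -EFinM divff ?gt_eqF// mul1e.
have xK' (y : \bar R) : x^-1%:E * (x%:E * y) = y.
  by rewrite muleA -EFinM mulVf ?gt_eqF// mul1e.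
rewrite -[leRHS]xK; apply: lee_wpmul2l; first by rewrite lee_fin ltW.
have : 0 <= x^-1%:E by rewrite lee_fin invr_ge0 ltW.
move=> /(@esum_scale_le T A _ (fun i => x%:E * a i)); under eq_esum do rewrite xK'.
by apply=> i; rewrite mule_ge0// lee_fin ltW.
Qed.

End EsumTools.

Section Fekete.
Context {R : realType}.
Variable a : nat -> R.
Hypothesis a_sub : forall m n, (0 < m)%N -> (0 < n)%N -> a (m + n)%N <= a m + a n.

Lemma subadditive_mul N q r : (0 < N)%N -> (0 < r)%N ->
  a (q * N + r)%N <= q%:R * a N + a r.
Proof.
move=> N0 r0; elim: q => [|q IH]; first by rewrite mul0n add0n mul0r add0r.
rewrite mulSn -addnA; apply: le_trans (a_sub N0 _) _.
  by rewrite addn_gt0 r0 orbT.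
by rewrite -natr1 mulrDl mul1r; lra.
Qed.

Lemma fekete_upper N (e : R) : (0 < N)%N -> 0 < e ->
  \forall n \near \oo, a n <= n%:R * (a N / N%:R + e).
Proof.
move=> N0 e0; have Np : 0 < N%:R :> R by rewrite ltr0n.
pose M := \sum_(r < N.+1) `|a r|.
have aM r : (r <= N)%N -> a r <= M.
  rewrite -ltnS => rN; apply: le_trans (ler_norm _) _.
  by rewrite /M (bigD1 (Ordinal rN))//= lerDl sumr_ge0.
near=> n.
have n0 : (0 < n)%N by near: n; exists 1%N.
have nM : `|a N| + M <= n%:R * e.
  rewrite -ler_pdivrMr//; near: n; exact: nbhs_infty_ger.
(* the remainder runs from 1 to [N] because subadditivity is only known for
   positive indices *)
set q := (n.-1 %/ N)%N; set r := ((n.-1 %% N).+1)%N.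
have nE : n = (q * N + r)%N by rewrite addnS -divn_eq prednK.
have rN : (r <= N)%N by rewrite /r ltn_mod.
rewrite {1}nE; apply: le_trans (subadditive_mul q N0 (ltn0Sn _)) _.
have qE : q%:R * a N = n%:R * (a N / N%:R) - r%:R / N%:R * a N.
  rewrite nE natrD natrM; field; exact: lt0r_neq0.
have rl : - (r%:R / N%:R * a N) <= `|a N|.
  apply: le_trans (ler_norm _) _; rewrite normrN normrM ler_piMl//.
  by rewrite ger0_norm ?divr_ge0// ler_pdivrMr// mul1r ler_nat.
have := aM r rN; rewrite qE mulrDr; lra.
Unshelve. all: by end_near. Qed.

(** Fekete's lemma; the linear lower bound makes the infimum finite. *)
Lemma fekete_cvg (k : R) : (forall n, (0 < n)%N -> n%:R * k <= a n) ->
  exists2 l, k <= l & a n / n%:R @[n --> \oo] --> l.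
Proof.
move=> ak.
pose S := [set a n / n%:R | n in [set n | (0 < n)%N]].
have Sk : lbound S k.
  by move=> _ [n n0 <-]; rewrite ler_pdivlMr ?ltr0n// mulrC ak.
have hS : has_inf S by split; [exists (a 1%N / 1%:R); exists 1%N|exists k].
exists (inf S); first exact: lb_le_inf hS.1 Sk.
apply/cvgrPdist_le => e e0; have e20 : 0 < e / 2 by rewrite divr_gt0.
have [_ [N /= N0 <-] aN] := inf_adherent e20 hS.
near=> n.
have n0 : (0 < n)%N by near: n; exists 1%N.
have np : 0 < n%:R :> R by rewrite ltr0n.
have h1 : inf S <= a n / n%:R by apply: (ge_inf hS.2); exists n.
have h2 : a n / n%:R <= a N / N%:R + e / 2.
  rewrite ler_pdivrMr// mulrC; near: n; exact: fekete_upper.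
by rewrite distrC ger0_norm ?subr_ge0//; lra.
Unshelve. all: by end_near. Qed.

End Fekete.

Section CountableCover.
Context {R : realType} {d : nat}.
Local Notation E := 'rV[R]_d.

Lemma hausdorff_dim_le_countable (T : countType) (A : set E) s : 0 <= s ->
  (forall delta e, 0 < delta -> 0 < e -> exists (W : set T) (U : T -> set E),
    [/\ A `<=` \bigcup_(w in W) U w,
        forall w, W w -> (ediam (U w) <= delta%:E)%E &
        (\esum_(w in W) diam_pow s (U w) <= e%:E)%E]) ->
  (hausdorff_dim A <= s%:E)%E.
Proof.
move=> s0 h; apply: hausdorff_dim_le => // delta e d0 e0.
have [W [U [AU Ud Ue]]] := h delta e d0 e0.
pose U' k : set E := if pickle_inv k is Some w then
  if w \in W then U w else set0 else set0.
have U'E w : W w -> U' (pickle w) = U w.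
  by move=> Ww; rewrite /U' pickleK_inv mem_set.
exists U'; split.
- by move=> x /AU[w Ww Ux]; exists (pickle w) => //; rewrite U'E.
- move=> k; rewrite /U'; case: (pickle_inv k) => [w|]; last by rewrite ediam_set0 leNye.
  case: ifPn => [/set_mem/Ud//|_]; by rewrite ediam_set0 leNye.
- rewrite nneseries_esumT; last by move=> k; exact: diam_pow_ge0.
  apply: le_trans Ue; rewrite (esumID (pickle @` W))//; last first.
    by move=> k _; exact: diam_pow_ge0.
  rewrite [X in (_ + X <= _)%E]esum1 ?adde0; last first.
    move=> k [_ nk]; rewrite /U'; case e1: (pickle_inv k) => [w|]; last first.
      exact: diam_pow_set0.
    case: ifPn => [/set_mem Ww|_]; last exact: diam_pow_set0.
    case: nk; exists w => //.
    by have := @pickle_invK T k; rewrite e1.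
  rewrite setTI esum_image; last by move=> w w' _ _; exact: (pcan_inj pickleK).
  by under eq_esum => w Ww do rewrite U'E//.
Qed.
End CountableCover.

(** * Pressure and the upper bound *)

Section Pressure.
Context {R : realType} {d : nat} {L : countType}.
Hypothesis d_gt0 : (0 < d)%N.
Local Notation E := 'rV[R]_d.
Variable phi : L -> E -> E.
Local Notation phiw := (phi_word phi).
Variables (rho K : R) (V : set E).
Hypothesis cd : conformal_data phi rho K V.
Variable f : E -> R.
Hypothesis f_gt0 : forall x, cube x -> 0 < f x.
Hypothesis f_tempered : tempered_distortion phi f.
Variable xi : seq L -> E.
Hypothesis xi_choice : cylinder_choice phi xi.
Variable i0 : L.
Implicit Types (x y z : E) (u v w : seq L) (om : nat -> L).

Local Notation pi := (coding phi).
Local Notation wn := (wnorm phi).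
Local Notation low := (low_sum phi f).
Local Notation Vs := (cylvar_sum phi f).
Let om0 : nat -> L := fun=> i0.

Let rho_gt0 : 0 < rho. Proof. by have /andP[] := cd_rho cd. Qed.
Let rho_lt1 : rho < 1. Proof. by have /andP[] := cd_rho cd. Qed.
Let K_gt0 : 0 < K. Proof. by apply: lt_le_trans (cd_K cd). Qed.

(** Up to a constant, a bound for the diameter of the set of points of the cylinder
    of [u] that return close to themselves after [size u] steps. *)
Definition weight u : R := wn u * expR (- low u).

Definition sample_weight u : R :=
  dnorm (phiw u) (phi_word_inv phi u (xi u)) * expR (- word_sum phi f u (xi u)).

Lemma weight_gt0 u : 0 < weight u.
Proof. by rewrite mulr_gt0 ?expR_gt0 ?(wnorm_gt0 d_gt0 cd). Qed.

Lemma weight_le u : weight u <= rho ^+ size u.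
Proof.
apply: le_trans (wnorm_le d_gt0 cd u); rewrite ler_piMr ?(ltW (wnorm_gt0 d_gt0 cd u))//.
by rewrite -expR0 ler_expR oppr_le0 (low_sum_ge0 d_gt0 cd f_gt0 u om0).
Qed.

Lemma weight_cat u v : weight (u ++ v) <= weight u * weight v.
Proof.
rewrite /weight mulrACA -expRD -opprD; apply: ler_pM.
- exact/ltW/(wnorm_gt0 d_gt0 cd).
- exact: expR_ge0.
- exact: (wnorm_cat_le d_gt0 cd).
- by rewrite ler_expR lerN2 (low_sum_cat d_gt0 cd f_gt0 u v om0).
Qed.

Let xi_coding u : u != [::] -> exists2 om, xi u = pi om & mkseq om (size u) = u.
Proof. by move=> /xi_choice[om e1 e2]; exists om. Qed.

Let dnorm_sample u om : mkseq om (size u) = u -> xi u = pi om ->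
  cube (phi_word_inv phi u (xi u)).
Proof.
move=> e ->; rewrite -{1}e (phi_word_inv_coding d_gt0 cd).
exact: (coding_cube d_gt0 cd).
Qed.

Lemma sample_weight_gt0 u : u != [::] -> 0 < sample_weight u.
Proof.
move=> /xi_coding[om e1 e2]; rewrite mulr_gt0 ?expR_gt0//.
apply: (dnorm_word_gt0 d_gt0 cd); apply: (cd_cubeV cd).
exact: dnorm_sample e2 e1.
Qed.

Let word_sum_sample u om : u != [::] -> mkseq om (size u) = u -> xi u = pi om ->
  word_sum phi f u (xi u) = orbit_sum phi f (size u) om.
Proof.
move=> u0 e ->; rewrite -{1}e (word_sum_coding d_gt0 cd)//.
by rewrite lt0n size_eq0.
Qed.

Lemma sample_weight_le u : u != [::] -> sample_weight u <= weight u.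
Proof.
move=> u0; have [om e1 e2] := xi_coding u0.
have cx := dnorm_sample e2 e1.
rewrite /sample_weight /weight; apply: ler_pM.
- by apply/ltW/(dnorm_word_gt0 d_gt0 cd)/(cd_cubeV cd).
- exact: expR_ge0.
- exact: (dnorm_le_wnorm d_gt0 cd).
- rewrite ler_expR lerN2 (word_sum_sample u0 e2 e1).
  by have := low_sum_le d_gt0 cd f_gt0 (size u) om; rewrite e2.
Qed.

Lemma weight_le_sample u : u != [::] ->
  weight u <= K * expR (Vs (size u)) * sample_weight u.
Proof.
move=> u0; have [om e1 e2] := xi_coding u0.
have cx := dnorm_sample e2 e1.
rewrite /sample_weight /weight mulrACA -expRD; apply: ler_pM.
- exact/ltW/(wnorm_gt0 d_gt0 cd).
- exact: expR_ge0.
- exact: (wnorm_le_dnorm d_gt0 cd _ (cd_cubeV cd cx)).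
- rewrite ler_expR (word_sum_sample u0 e2 e1).
  have := orbit_sum_le_low d_gt0 cd f_gt0 f_tempered (size u) om; rewrite e2; lra.
Qed.

Definition level_sum s n : \bar R :=
  (\esum_(u in [set u : seq L | size u = n]) (weight u `^ s)%:E)%E.

Definition sample_sum s n : \bar R :=
  (\esum_(w in [set: n.-tuple L]) (sample_weight w `^ s)%:E)%E.

Lemma sample_sumE s n : sample_sum s n =
  (\esum_(u in [set u : seq L | size u = n]) (sample_weight u `^ s)%:E)%E.
Proof.
rewrite /sample_sum (@reindex_esum _ _ _ [set: n.-tuple L] _ val)//; split.
- by move=> w _ /=; rewrite size_tuple.
- by move=> w w' _ _; exact: val_inj.
- move=> u /= /eqP un; exists (Tuple un) => //.
Qed.

Lemma pressureE s : pressure phi xi f s =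
  limn (fun n => ((n%:R^-1)%:E * lne (sample_sum s n))%E).
Proof. by []. Qed.

Let pow_ge0 (g : seq L -> R) s u : (0 <= (g u `^ s)%:E)%E.
Proof. by rewrite lee_fin powR_ge0. Qed.

Let pow_le (x y s : R) : 0 <= s -> 0 < x -> x <= y -> x `^ s <= y `^ s.
Proof.
move=> s0 x0 xy; apply: ge0_ler_powR => //; rewrite nnegrE ltW//.
exact: lt_le_trans xy.
Qed.

(** The level sums bound the sums of the pressure from above, and from below up
    to the factor [(K * expR (Vs n)) `^ s], which is [expR (o(n))]. *)
Lemma sample_sum_le s n : 0 <= s -> (0 < n)%N ->
  (sample_sum s n <= level_sum s n)%E.
Proof.
move=> s0 n0; rewrite sample_sumE; apply: le_esum => u /= un.
have u0 : u != [::] by rewrite -size_eq0 un -lt0n.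
by rewrite lee_fin pow_le ?sample_weight_gt0 ?sample_weight_le.
Qed.

Lemma level_sum_le_sample s n : 0 <= s -> (0 < n)%N ->
  (level_sum s n <= ((K * expR (Vs n)) `^ s)%:E * sample_sum s n)%E.
Proof.
move=> s0 n0; have c0 : 0 < K * expR (Vs n) by rewrite mulr_gt0 ?expR_gt0.
have p0 : (0 <= ((K * expR (Vs n)) `^ s)%:E)%E by rewrite lee_fin powR_ge0.
rewrite sample_sumE.
apply: le_trans (esum_scale_le _ p0 (pow_ge0 sample_weight s)).
apply: le_esum => u /= un.
have u0 : u != [::] by rewrite -size_eq0 un -lt0n.
rewrite -EFinM lee_fin -powRM ?(ltW c0) ?(ltW (sample_weight_gt0 u0))//.
by apply: pow_le => //; [exact: weight_gt0|rewrite -un; exact: weight_le_sample].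
Qed.

Lemma level_sum_gt0 s n : (0 < level_sum s n)%E.
Proof.
apply: lt_le_trans (_ : (weight (nseq n i0) `^ s)%:E <= _)%E.
  by rewrite lte_fin powR_gt0 ?weight_gt0.
rewrite -[leLHS](@esum_set1 _ _ (nseq n i0) (fun u => (weight u `^ s)%:E))//.
by apply: subset_esum => // u ->; rewrite /= size_nseq.
Qed.

Lemma level_sumD s m n : 0 <= s ->
  (level_sum s (m + n) <= level_sum s m * level_sum s n)%E.
Proof.
move=> s0.
have e : set_bij ([set u : seq L | size u = m] `*`` (fun=> [set v | size v = n]))
    [set u : seq L | size u = (m + n)%N] (fun k => k.1 ++ k.2).
  split.
  - by move=> [u v] [/= um vn]; rewrite size_cat um vn.
  - move=> [u v] [u' v'] /set_mem[/= um vn] /set_mem[/= um' vn'] e.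
    have /andP[/eqP -> /eqP ->] // : (u == u') && (v == v').
    by rewrite -eqseq_cat ?um ?um'// e.
  - move=> w /= wmn; exists (take m w, drop m w); last exact: cat_take_drop.
    by split; rewrite /= ?size_drop ?wmn ?addKn// size_takel// wmn leq_addr.
rewrite /level_sum (reindex_esum _ _ _ _ e).
apply: le_trans (_ : (\esum_(k in [set u : seq L | size u = m] `*``
    (fun=> [set v : seq L | size v = n])) (weight k.1 `^ s * weight k.2 `^ s)%:E <= _)%E).
  apply: le_esum => -[u v] _ /=; rewrite lee_fin -powRM ?(ltW (weight_gt0 _))//.
  by apply: pow_le => //; [exact: weight_gt0|exact: weight_cat].
rewrite -(@esum_esum _ _ _ _ _ (fun u v => (weight u `^ s * weight v `^ s)%:E));
  last first.
  by move=> u v _ _; rewrite lee_fin mulr_ge0 ?powR_ge0.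
have b0 : (0 <= level_sum s n)%E by apply: esum_ge0 => u _; exact: pow_ge0.
rewrite muleC; apply: le_trans (esum_scale_le _ b0 (pow_ge0 weight s)).
apply: le_esum => u _; rewrite muleC.
apply: le_trans (esum_scale_le _ (pow_ge0 weight s u) (pow_ge0 weight s)).
by apply: le_esum => v _; rewrite EFinM.
Qed.

(** One letter carries the full sum up to a constant once the rest of the word
    is fixed. *)
Lemma level_sum1_le s n : 0 <= s -> (0 < n)%N ->
  exists2 c : R, 0 < c & (c%:E * level_sum s 1 <= level_sum s n)%E.
Proof.
move=> s0; case: n => // n _.
pose w := mkseq om0 n.
pose c0 := wn w / K * expR (- (orbit_sum phi f n om0 + cylvar phi f 1)).
have c00 : 0 < c0 by rewrite mulr_gt0 ?expR_gt0 ?divr_gt0 ?(wnorm_gt0 d_gt0 cd).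
exists (c0 `^ s); first by rewrite powR_gt0.
apply: le_trans (esum_scale_ge _ (powR_gt0 s c00) (pow_ge0 weight s)) _.
apply: le_trans (_ : (\esum_(u in [set u : seq L | size u = 1%N])
   (weight (u ++ w) `^ s)%:E <= _)%E); last first.
  rewrite -(@esum_image _ _ _ _ (fun u => u ++ w) (fun u => (weight u `^ s)%:E)).
    apply: subset_esum => // _ [u /= u1 <-].
    by rewrite /= size_cat u1 size_mkseq.
  move=> u u' /set_mem/= u1 /set_mem/= u1' /(congr1 (take 1)).
  by rewrite !take_size_cat.
apply: le_esum => u /= u1; rewrite -EFinM lee_fin.
rewrite -powRM ?(ltW (weight_gt0 _)) ?(ltW c00)//.
apply: pow_le => //; first by rewrite mulr_gt0 ?weight_gt0.
rewrite /weight /c0 mulrACA -expRD; apply: ler_pM.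
- by rewrite mulr_ge0 ?divr_ge0 ?ltW ?(wnorm_gt0 d_gt0 cd).
- exact: expR_ge0.
- rewrite mulrAC (ler_pdivrMr _ _ K_gt0) [leLHS]mulrC [leRHS]mulrC.
  exact: (wnorm_cat_ge d_gt0 cd u w).
rewrite ler_expR.
pose om := catw u om0.
have e1 : mkseq om 1 = u by rewrite -u1 mkseq_catw.
have e2 : shiftn 1 om = om0 by rewrite -u1 shiftn_catw.
have h1 := low_sum_le d_gt0 cd f_gt0 (1 + n) om.
rewrite mkseqD e1 e2 -/w orbit_sumD e2 in h1.
have h2 := orbit_sum_le_low d_gt0 cd f_gt0 f_tempered 1 om.
rewrite e1 /cylvar_sum big_ord1 in h2.
lra.
Qed.

Lemma level_sum_fin s N n : 0 <= s -> (0 < N)%N -> (level_sum s N < +oo)%E ->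
  level_sum s n.+1 \is a fin_num.
Proof.
move=> s0 N0 hN.
have ge0 k : (0 <= level_sum s k)%E by exact/ltW/level_sum_gt0.
have [c c0 cN] := level_sum1_le s0 N0.
have f1 : level_sum s 1 \is a fin_num.
  rewrite ge0_fin_numE//; have := le_lt_trans cN hN.
  have := level_sum_gt0 s 1; case: (level_sum s 1) => // [r _ _|_]; first exact: ltry.
  by rewrite gt0_muley// lte_fin.
elim: n => // n IH; rewrite ge0_fin_numE//.
apply: le_lt_trans (level_sumD 1 n.+1 s0) _.
by rewrite -ge0_fin_numE ?mule_ge0// fin_numM.
Qed.

Definition log_sum s n : R := ln (fine (level_sum s n)).

Section FiniteSums.
Variables (s : R) (N : nat).
Hypothesis s_ge0 : 0 <= s.
Hypothesis N_gt0 : (0 < N)%N.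
Hypothesis sN : (level_sum s N < +oo)%E.

Lemma fine_level_sum_gt0 n : (0 < n)%N -> 0 < fine (level_sum s n).
Proof.
case: n => // n _; apply: fine_gt0; rewrite level_sum_gt0/=.
rewrite -ge0_fin_numE ?ltW ?level_sum_gt0//.
exact: level_sum_fin sN.
Qed.

Lemma log_sumK n : (0 < n)%N -> level_sum s n = (expR (log_sum s n))%:E.
Proof.
move=> n0; rewrite /log_sum lnK ?posrE ?fine_level_sum_gt0//.
by case: n n0 => // n _; rewrite fineK// (level_sum_fin _ _ _ sN).
Qed.

Lemma log_sumD m n : (0 < m)%N -> (0 < n)%N ->
  log_sum s (m + n) <= log_sum s m + log_sum s n.
Proof.
move=> m0 n0; rewrite -ler_expR expRD -lee_fin EFinM -!log_sumK ?addn_gt0 ?m0//.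
exact: level_sumD.
Qed.

End FiniteSums.

(** If all level sums with exponent [s] were at least 1, those with the smaller
    exponent [s0] would grow exponentially, since weights are at most
    [rho ^+ n].  By Fekete's lemma the sequence of the pressure at [s0] converges,
    so its limit would be positive. *)
Lemma level_sum_lt1 s0 s : 0 <= s0 -> s0 < s ->
  (pressure phi xi f s0 <= 0)%E -> exists2 N, (0 < N)%N & (level_sum s N < 1)%E.
Proof.
move=> s00 s0s; apply: contraPP => nex; apply/negP; rewrite -ltNge.
have {nex}ge1 n : (0 < n)%N -> (1 <= level_sum s n)%E.
  by move=> n0; rewrite leNgt; apply/negP => h; apply: nex; exists n.
have s_ge0 : 0 <= s by apply: le_trans s00 (ltW s0s).
pose k := (s - s0) * - ln rho.
have k0 : 0 < k by rewrite mulr_gt0 ?subr_gt0// oppr_gt0 ln_lt0// rho_gt0 rho_lt1.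
have low n : (0 < n)%N -> ((expR (n%:R * k))%:E <= level_sum s0 n)%E.
  move=> n0; have e0 : 0 < expR (- (n%:R * k)) by exact: expR_gt0.
  have h : (level_sum s n <= (expR (- (n%:R * k)))%:E * level_sum s0 n)%E.
    apply: le_trans (esum_scale_le _ _ (pow_ge0 weight s0)); last by rewrite lee_fin ltW.
    apply: le_esum => u /= un; rewrite -EFinM lee_fin.
    have w0 := weight_gt0 u.
    rewrite [leLHS](_ : _ = weight u `^ (s - s0) * weight u `^ s0); last first.
      by rewrite -powRD ?subrK// (gt_eqF w0) implybT.
    rewrite ler_wpM2r ?powR_ge0//.
    apply: le_trans (pow_le _ w0 (weight_le u)) _; first by rewrite subr_ge0 ltW.
    rewrite /powR gt_eqF ?exprn_gt0// un lnXn// -mulr_natl ler_expR.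
    by rewrite /k; have := mulrC (s - s0) (ln rho); set x := s - s0; lra.
  have := le_trans (ge1 n n0) h.
  by rewrite expRN lee_pdivlMl ?expR_gt0// mule1.
have sn n : (0 < n)%N -> (level_sum s0 n <=
    ((K * expR (Vs n)) `^ s0)%:E * sample_sum s0 n)%E by exact: level_sum_le_sample.
have Z_ge0 n : (0 <= sample_sum s0 n)%E by apply: esum_ge0 => w _; exact: pow_ge0.
rewrite pressureE.
have [fin|] := ltP (level_sum s0 1) +oo%E; last first.
  rewrite leye_eq => /eqP inf1.
  have Zy n : (0 < n)%N -> sample_sum s0 n = +oo%E.
    move=> n0; have [c c0] := level_sum1_le s00 n0.
    rewrite inf1 gt0_muley ?lte_fin// leye_eq => /eqP infn.
    apply/eqP; apply: contraT; rewrite -ltey -ge0_fin_numE// => Zfin.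
    have := sn n n0; rewrite infn leye_eq => /eqP h.
    by have := fin_numM (fin_numE (((K * expR (Vs n)) `^ s0)%:E)) Zfin; rewrite h.
  suff -> : limn (fun n => ((n%:R^-1)%:E * lne (sample_sum s0 n))%E) = +oo%E by [].
  apply: lim_near_cst; first exact: ereal_hausdorff.
  near=> n; have n0 : (0 < n)%N by near: n; exists 1%N.
  by rewrite Zy//= gt0_muley// lte_fin invr_gt0 ltr0n.
have aK n : (0 < n)%N -> level_sum s0 n = (expR (log_sum s0 n))%:E.
  by exact: (log_sumK s00 (ltn0Sn 0) fin).
have [l kl al] : exists2 l, k <= l & log_sum s0 n / n%:R @[n --> \oo] --> l.
  apply: fekete_cvg => [m n m0 n0|n n0]; first exact: (log_sumD s00 (ltn0Sn 0) fin m0 n0).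
  by rewrite -ler_expR -lee_fin -aK//; exact: low.
pose z n := ln (fine (sample_sum s0 n)).
have zE n : (0 < n)%N -> [/\ (0 < sample_sum s0 n)%E,
    sample_sum s0 n = (expR (z n))%:E, z n <= log_sum s0 n &
    log_sum s0 n - s0 * (ln K + Vs n) <= z n].
  move=> n0; have c0 : 0 < K * expR (Vs n) by rewrite mulr_gt0 ?expR_gt0.
  have h1 := sn n n0; have h2 := sample_sum_le s00 n0.
  rewrite aK// in h1 h2.
  have Zf : sample_sum s0 n \is a fin_num.
    by rewrite ge0_fin_numE//; apply: le_lt_trans h2 (ltry _).
  rewrite -(fineK Zf) in h1 h2.
  have Zp : 0 < fine (sample_sum s0 n).
    rewrite lt0r fine_ge0// andbT; apply: contraTneq h1 => ->.
    by rewrite mule0 lee_fin -ltNge expR_gt0.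
  have e : fine (sample_sum s0 n) = expR (z n) by rewrite lnK.
  split.
  - by rewrite -(fineK Zf) lte_fin.
  - by rewrite -(fineK Zf) e.
  - by rewrite -ler_expR -e -lee_fin.
  - move: h1; rewrite e -EFinM lee_fin /powR gt_eqF// -expRD ler_expR.
    by rewrite lnM ?posrE ?expR_gt0// expRK; lra.
have zl : n%:R^-1 * z n @[n --> \oo] --> l.
  have inv0 : n%:R^-1 @[n --> \oo] --> (0 : R).
    apply/gtr0_cvgV0; last exact: cvgr_idn.
    by near=> n; rewrite ltr0n; near: n; exists 1%N.
  apply: (@squeeze_cvgr _ _ _ _ (fun n => log_sum s0 n / n%:R -
     s0 * (ln K * n%:R^-1 + Vs n / n%:R)) (fun n => log_sum s0 n / n%:R)) => //.
    near=> n; have n0 : (0 < n)%N by near: n; exists 1%N.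
    have np : 0 < (n%:R : R)^-1 by rewrite invr_gt0 ltr0n.
    have [_ _ h1 h2] := zE n n0.
    rewrite (mulrC _ (z n)) ler_wpM2r ?(ltW np)// andbT.
    by rewrite -mulrDl mulrA -mulrBl ler_wpM2r ?(ltW np).
  rewrite -[X in _ --> X]subr0; apply: cvgB => //.
  rewrite -(mulr0 s0); apply: cvgMl_tmp.
  rewrite -[X in _ --> X]addr0; apply: cvgD; last exact: cylvar_sum_mean.
  by rewrite -(mulr0 (ln K)); apply: cvgMl_tmp.
have -> : limn (fun n => ((n%:R^-1)%:E * lne (sample_sum s0 n))%E) = l%:E.
  apply: cvg_lim; first exact: ereal_hausdorff.
  have : (n%:R^-1 * z n)%:E @[n --> \oo] --> l%:E by apply: cvg_EFin => //; exact: nearW.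
  apply: cvg_trans; apply: near_eq_cvg; near=> n.
  have n0 : (0 < n)%N by near: n; exists 1%N.
  have [_ -> _ _] := zE n n0.
  by rewrite lne_EFin ?expR_gt0// expRK EFinM.
by rewrite lte_fin (lt_le_trans k0).
Unshelve. all: by end_near. Qed.

(** Once one level sum is below 1, submultiplicativity makes them decay. *)
Lemma level_sum_decay s N : 0 <= s -> (0 < N)%N -> (level_sum s N < 1)%E ->
  exists2 c, 0 < c & \forall n \near \oo, (level_sum s n <= (expR (- (n%:R * c)))%:E)%E.
Proof.
move=> s0 N0 h.
have fin : (level_sum s N < +oo)%E by apply: lt_trans h (ltry 1).
have aK n : (0 < n)%N -> level_sum s n = (expR (log_sum s n))%:E.
  by exact: (log_sumK s0 N0 fin).
have aN : log_sum s N < 0.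
  by move: h; rewrite aK// lte_fin -[X in _ < X]expR0 ltr_expR.
have Np : 0 < N%:R :> R by rewrite ltr0n.
pose c := - (log_sum s N / N%:R) / 2.
have c0 : 0 < c by rewrite divr_gt0// oppr_gt0 pmulr_llt0 ?invr_gt0.
exists c => //; near=> n.
have n0 : (0 < n)%N by near: n; exists 1%N.
rewrite aK// lee_fin ler_expR -mulrN.
have -> : - c = log_sum s N / N%:R + c by rewrite /c; lra.
near: n; apply: fekete_upper => // m n m0 n0; exact: (log_sumD s0 N0 fin m0 n0).
Unshelve. all: by end_near. Qed.


Definition return_set u : set E := [set x | exists om,
  [/\ x = pi om, mkseq om (size u) = u &
      enorm (pi (shiftn (size u) om) - pi om) < expR (- orbit_sum phi f (size u) om)]].

(** If [x = phi_u y] and [x' = phi_u y'] return, then [y] and [y'] are close to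
    [x] and [x'], which are within [rho * |y - y'|] of each other; so [|y - y'|] is
    of the order of the return radius. *)
Lemma ediam_return_set u : u != [::] ->
  (ediam (return_set u) <= (2 / (1 - rho) * weight u)%:E)%E.
Proof.
move=> u0; apply: ediam_le => _ _ [om [-> e r]] [om' [-> e' r']]; rewrite lee_fin.
have c := coding_cube d_gt0 cd.
set n := size u in e e' r r'.
set y := pi (shiftn n om) in r; set y' := pi (shiftn n om') in r'.
have xE : pi om = phiw u y by rewrite (coding_shiftn d_gt0 cd n om) e.
have xE' : pi om' = phiw u y' by rewrite (coding_shiftn d_gt0 cd n om') e'.
have cy : cube y := c _; have cy' : cube y' := c _.
pose D := expR (- low u).
have rD : enorm (y - pi om) <= D.
  apply: le_trans (ltW r) _; rewrite ler_expR lerN2.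
  by have := low_sum_le d_gt0 cd f_gt0 n om; rewrite e.
have rD' : enorm (y' - pi om') <= D.
  apply: le_trans (ltW r') _; rewrite ler_expR lerN2.
  by have := low_sum_le d_gt0 cd f_gt0 n om'; rewrite e'.
have contr : enorm (pi om - pi om') <= rho * enorm (y - y').
  rewrite xE xE'; apply: le_trans (phi_word_contr cd u cy cy') _.
  rewrite ler_wpM2r ?enorm_ge0//.
  case: (u) u0 => //= i v _; rewrite exprS ler_piMr ?(ltW rho_gt0)//.
  by rewrite exprn_ile1 ?(ltW rho_gt0) ?(ltW rho_lt1).
have h1 := ler_enorm_dist (pi om) y y'.
have h2 := ler_enorm_dist (pi om') (pi om) y'.
rewrite (enormB (pi om') y') in h2.
have yy : enorm (y - y') <= 2 * D / (1 - rho).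
  by rewrite ler_pdivlMr ?subr_gt0//; lra.
rewrite xE xE'; apply: le_trans (phi_word_lipschitz d_gt0 cd u cy cy') _.
rewrite /weight -/D [leRHS](_ : _ = wn u * (2 * D / (1 - rho))); last by ring.
by rewrite ler_wpM2l// (ltW (wnorm_gt0 d_gt0 cd u)).
Qed.

Lemma recurrence_setE x n0 : recurrence_set phi f x ->
  exists2 u, (n0 <= size u)%N & return_set u x.
Proof.
move=> [Jx inf]; have [om _ xE] := Jx.1; rewrite -{x}xE in Jx inf *.
have [n [n0n rn]] : exists n, (n0 <= n)%N /\
    enorm (iter n (shift_map phi) (pi om) - pi om) <
      expR (- birkhoff_sum phi f n (pi om)).
  apply: contrapT => nex; apply: inf.
  apply: (@sub_finite_set _ _ `I_n0); last exact: finite_II.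
  move=> n /= rn; rewrite ltnNge; apply/negP => n0n; apply: nex; by exists n.
exists (mkseq om n); first by rewrite size_mkseq.
exists om; rewrite size_mkseq; split => //.
by rewrite -(iter_shift_map_coding d_gt0 cd)// -(birkhoff_sum_coding d_gt0 cd).
Qed.

Lemma geometric_tail (x : R) n0 N : 0 < x < 1 ->
  \sum_(0 <= n < N) (if (n0 <= n)%N then x ^+ n else 0) <= x ^+ n0 / (1 - x).
Proof.
move=> /andP[x0 x1]; have p : 0 < 1 - x by rewrite subr_gt0.
suff h : \sum_(0 <= n < N) (if (n0 <= n)%N then x ^+ n else 0) * (1 - x) <=
    x ^+ n0 - x ^+ maxn n0 N.
  rewrite ler_pdivlMr// mulr_suml; apply: le_trans h _.
  by rewrite lerBlDr lerDl exprn_ge0 ?ltW.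
elim: N => [|N IH]; first by rewrite big_geq// maxn0 subrr.
rewrite big_nat_recr//=; case: ifPn => [nN|].
  rewrite (maxn_idPr nN) in IH; rewrite (maxn_idPr (leqW nN)) exprSr; lra.
rewrite -ltnNge => Nn; rewrite (maxn_idPl Nn) mul0r addr0.
by rewrite (maxn_idPl (ltnW Nn)) in IH.
Qed.

Lemma recurrence_dim_le_real s N : 0 < s -> (0 < N)%N -> (level_sum s N < 1)%E ->
  (hausdorff_dim (recurrence_set phi f) <= s%:E)%E.
Proof.
move=> s0 N0 sN; have [c c0 decay] := level_sum_decay (ltW s0) N0 sN.
apply: (@hausdorff_dim_le_countable _ _ (seq L)); first exact: ltW.
move=> delta e delta0 e0.
pose D := 2 / (1 - rho); have D0 : 0 < D by rewrite divr_gt0 ?subr_gt0.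
pose x := expR (- c).
have x01 : 0 < x < 1 by rewrite expR_gt0 -expR0 ltr_expR oppr_lt0.
have /andP[x0 x1] := x01.
have pD : 0 < D `^ s by rewrite powR_gt0.
have e1 : 0 < e * (1 - x) / D `^ s by rewrite divr_gt0 ?mulr_gt0 ?subr_gt0.
have e2 : 0 < delta / D by rewrite divr_gt0.
have [n0 [n00 n0rho n0x n0d]] : exists n0 : nat, [/\ (0 < n0)%N,
    rho ^+ n0 <= delta / D, x ^+ n0 <= e * (1 - x) / D `^ s &
    forall n, (n0 <= n)%N -> (level_sum s n <= (x ^+ n)%:E)%E].
  have r1 : rho ^+ n @[n --> \oo] --> (0 : R) by apply: cvg_expr; rewrite gtr0_norm.
  have r2 : x ^+ n @[n --> \oo] --> (0 : R) by apply: cvg_expr; rewrite gtr0_norm.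
  have [N1 _ h1] := decay.
  move: r1 => /cvgr0Pnorm_le/(_ _ e2)[N2 _ h2].
  move: r2 => /cvgr0Pnorm_le/(_ _ e1)[N3 _ h3].
  exists (N1 + N2 + N3).+1; split => //.
  - apply: le_trans (h2 (N1 + N2 + N3).+1 _); first exact: ler_norm.
    by rewrite /= leqW// (addnC N1) -addnA leq_addr.
  - apply: le_trans (h3 (N1 + N2 + N3).+1 _); first exact: ler_norm.
    by rewrite /= leqW// leq_addl.
  - move=> n nn; have := h1 n; rewrite /= => /(_ _); rewrite /x -expRM_natl mulrN.
    by apply; apply: leq_trans nn; rewrite leqW// -addnA leq_addr.
exists [set u | (n0 <= size u)%N], return_set.
have nnil u : (n0 <= size u)%N -> u != [::].
  by move=> h; rewrite -size_eq0 -lt0n; apply: leq_trans h.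
split.
- by move=> y /(recurrence_setE n0)[u un ru]; exists u.
- move=> u /= un; apply: le_trans (ediam_return_set (nnil u un)) _.
  rewrite lee_fin -/D -ler_pdivlMl// mulrC; apply: le_trans n0rho.
  apply: le_trans (weight_le u) _.
  by apply: ler_wiXn2l => //; rewrite ltW.
pose F n := [set u : seq L | size u = n /\ (n0 <= n)%N].
have -> : [set u : seq L | (n0 <= size u)%N] = \bigcup_n F n.
  by apply/seteqP; split => [u /= un|u [n _ [<-]]//]; exists (size u).
have diam_le u : (n0 <= size u)%N ->
    (diam_pow s (return_set u) <= (D `^ s)%:E * (weight u `^ s)%:E)%E.
  move=> un; rewrite /diam_pow; case: ifPn => [_|/set0P[y ry]].
    by rewrite -EFinM lee_fin mulr_ge0 ?powR_ge0.
  have h := ediam_return_set (nnil u un); have g := ediam_ge0 ry.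
  move: h g; case: (ediam (return_set u)) => // b h g.
  rewrite lee_fin -/D in h; rewrite lee_fin in g.
  rewrite poweR_EFin -EFinM lee_fin.
  rewrite -powRM ?(ltW D0) ?(ltW (weight_gt0 u))//.
  apply: ge0_ler_powR; rewrite ?nnegrE ?(ltW s0)//.
  by rewrite (le_trans g h).
rewrite nneseries_sum_bigcup; first last.
- by move=> u; exact: diam_pow_ge0.
- move=> m n _ _ [u [[<- _] [<- _]]]; by [].
apply: lime_le.
  apply: is_cvg_nneseries => n _ _; apply: esum_ge0 => u _.
  exact: diam_pow_ge0.
apply: nearW => M.
apply: le_trans (_ : ((D `^ s * \sum_(0 <= n < M)
    (if (n0 <= n)%N then x ^+ n else 0))%:E <= _)%E); last first.
  rewrite lee_fin -ler_pdivlMl// mulrC.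
  apply: le_trans (geometric_tail n0 M x01) _.
  by rewrite ler_pdivrMr ?subr_gt0// mulrAC.
rewrite mulr_sumr -sumEFin; apply: lee_sum => n _.
case: ifPn => n0n; last first.
  rewrite mulr0 esum1// => u [_]; by rewrite (negPf n0n).
rewrite EFinM; apply: le_trans (_ : ((D `^ s)%:E * level_sum s n <= _)%E); last first.
  by apply: lee_wpmul2l; [rewrite lee_fin ltW|exact: n0d].
have pDE : (0 <= (D `^ s)%:E)%E by rewrite lee_fin ltW.
apply: le_trans (esum_scale_le _ pDE (pow_ge0 weight s)).
apply: le_trans (_ : (\esum_(u in F n) ((D `^ s)%:E * (weight u `^ s)%:E) <= _)%E).
  by apply: le_esum => u [un _]; apply: diam_le; rewrite un.
apply: subset_esum; last by move=> u [].
by move=> u; rewrite -EFinM lee_fin mulr_ge0 ?powR_ge0.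
Qed.

Lemma recurrence_dim_le :
  (hausdorff_dim (recurrence_set phi f) <= s_exponent phi xi f)%E.
Proof.
apply: le_ereal_inf_tmp => _ [s [s0 Ps] <-].
apply/lee_addgt0Pr => e e0; rewrite -EFinD.
have se : s < s + e by rewrite ltrDl.
have [N N0 sN] := level_sum_lt1 s0 se Ps.
exact: recurrence_dim_le_real (le_lt_trans s0 se) N0 sN.
Qed.

End Pressure.

From mathcomp Require Import finmap.

(** * The lower bound *)

Lemma infinite_set_unbounded (A : set nat) :
  (forall N, exists2 n, (N < n)%N & A n) -> infinite_set A.
Proof.
move=> h fA; pose N := (\sum_(i <- fset_set A) i)%N.
have [n Nn An] := h N; move: Nn; rewrite ltnNge => /negP; apply.
have nA : n \in fset_set A by rewrite in_fset_set//; exact: mem_set.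
by rewrite /N (big_rem _ nA)/= leq_addr.
Qed.

Section Blocks.
Context {A L : eqType}.
Variables (wd : A -> seq L) (m : nat) (i0 : L).
Hypothesis m_gt0 : (0 < m)%N.
Hypothesis wd_inj : injective wd.
Hypothesis wd_size : forall a, size (wd a) = m.
Implicit Types (u v : seq A) (om : nat -> A).

Definition flat u : seq L := flatten [seq wd a | a <- u].

Definition block_path om : nat -> L := fun n => nth i0 (wd (om (n %/ m)%N)) (n %% m).

Lemma flat_cat u v : flat (u ++ v) = flat u ++ flat v.
Proof. by rewrite /flat map_cat flatten_cat. Qed.

Lemma size_flat u : size (flat u) = (size u * m)%N.
Proof. by elim: u => //= a u IH; rewrite size_cat IH wd_size mulSn. Qed.

Lemma shiftn_block_path n om :
  shiftn (n * m) (block_path om) = block_path (shiftn n om).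
Proof.
by apply/funext => k; rewrite /shiftn /block_path divnMDl// modnMDl.
Qed.

Lemma mkseq_block_path1 om : mkseq (block_path om) m = wd (om 0%N).
Proof.
apply: (@eq_from_nth _ i0); rewrite size_mkseq ?wd_size// => i im.
by rewrite nth_mkseq// /block_path divn_small// modn_small.
Qed.

Lemma mkseq_block_path n om : mkseq (block_path om) (n * m) = flat (mkseq om n).
Proof.
elim: n => // n IH; rewrite mulSnr mkseqD IH shiftn_block_path mkseq_block_path1.
by rewrite mkseqS -cats1 flat_cat /flat/= cats0 /shiftn addn0.
Qed.

Lemma prefix_flat u v : prefix (flat u) (flat v) = prefix u v.
Proof.
elim: u v => [|a u IH] [|b v]; rewrite ?prefix0s//.
  apply/negbTE/negP => /size_prefix; rewrite !size_flat /= mul0n leqn0.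
  by rewrite muln_eq0 /= eqn0Ngt m_gt0.
rewrite prefix_cons -IH; rewrite /flat/= prefix_catr ?wd_size//.
by rewrite (inj_eq wd_inj).
Qed.

End Blocks.

Section LowerBound.
Context {R : realType} {d : nat} {L : countType}.
Hypothesis d_gt0 : (0 < d)%N.
Local Notation E := 'rV[R]_d.
Variable phi : L -> E -> E.
Local Notation phiw := (phi_word phi).
Variables (rho K : R) (V : set E).
Hypothesis cd : conformal_data phi rho K V.
Variable f : E -> R.
Hypothesis f_gt0 : forall x, cube x -> 0 < f x.
Hypothesis f_tempered : tempered_distortion phi f.
Variable xi : seq L -> E.
Hypothesis xi_choice : cylinder_choice phi xi.
Variable i0 : L.

Local Notation pi := (coding phi).
Local Notation wn := (wnorm phi).
Local Notation low := (low_sum phi f).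
Local Notation Vs := (cylvar_sum phi f).

Let rho_gt0 : 0 < rho. Proof. by have /andP[] := cd_rho cd. Qed.
Let rho_lt1 : rho < 1. Proof. by have /andP[] := cd_rho cd. Qed.
Let K_gt0 : 0 < K. Proof. by apply: lt_le_trans (cd_K cd). Qed.

(** The weight of a block of length [m], lowered by the distortion constants so
    that it is a lower bound for the contribution of the block in any
    concatenation. *)
Definition block_weight m u : R := wn u / K * expR (- (low u + Vs m)).

Lemma block_weight_gt0 m u : 0 < block_weight m u.
Proof. by rewrite mulr_gt0 ?expR_gt0 ?divr_gt0 ?(wnorm_gt0 d_gt0 cd). Qed.

Section FiniteBlocks.
Variables (A : finType) (wd : A -> seq L) (m : nat) (t : R).
Hypothesis m_gt0 : (0 < m)%N.
Hypothesis wd_inj : injective wd.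
Hypothesis wd_size : forall a, size (wd a) = m.
Hypothesis t_gt0 : 0 < t.
Hypothesis sum_gt1 : 1 < \sum_a block_weight m (wd a) `^ t.

Let Y : R := \sum_a block_weight m (wd a) `^ t.
Let Q (u : seq A) : R := wn (flat wd u).
Let G a : R := low (wd a) + Vs m.
Let p a : R := block_weight m (wd a) `^ t / Y.
Let c : R := \big[Order.min/1]_a wn (wd a).
Let path (om : nat -> A) : nat -> L := block_path wd m i0 om.
Let om0 : nat -> L := fun=> i0.

Let Y_gt0 : 0 < Y. Proof. by apply: lt_trans sum_gt1. Qed.

Let Q_gt0 u : 0 < Q u. Proof. exact: (wnorm_gt0 d_gt0 cd). Qed.

Let Q1 a : Q [:: a] = wn (wd a).
Proof. by rewrite /Q /flat /= cats0. Qed.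

Let c_gt0 : 0 < c.
Proof.
rewrite /c; elim/big_ind: _ => // [x y x0 y0|a _]; first by rewrite lt_min x0.
exact: (wnorm_gt0 d_gt0 cd).
Qed.

Let Q_ge a : c <= Q [:: a].
Proof. by rewrite Q1 /c (bigD1 a)//= ge_min lexx. Qed.

Let Q_nil : Q [::] = 1.
Proof. exact: (wnorm_nil d_gt0 cd). Qed.

Let Q_cat u v : Q u * Q v <= K * Q (u ++ v).
Proof. by rewrite /Q flat_cat; exact: (wnorm_cat_ge d_gt0 cd). Qed.

Let Q_cat_le u v : Q (u ++ v) <= Q u.
Proof.
rewrite /Q flat_cat; apply: le_trans (wnorm_cat_le d_gt0 cd _ _) _.
by rewrite ler_piMr ?(ltW (Q_gt0 u)) ?(wnorm_le1 d_gt0 cd).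
Qed.

Let Q_le u : Q u <= rho ^+ size u.
Proof.
apply: le_trans (wnorm_le d_gt0 cd _) _; rewrite (size_flat wd_size).
by apply: ler_wiXn2l; [exact: ltW|exact: ltW|rewrite leq_pmulr].
Qed.

Let G_ge0 a : 0 <= G a.
Proof.
apply: addr_ge0; first exact: (low_sum_ge0 d_gt0 cd f_gt0 _ om0).
exact: (cylvar_sum_ge0 _ _ _ om0).
Qed.

Let p_gt0 a : 0 < p a.
Proof. by rewrite divr_gt0// powR_gt0 ?block_weight_gt0. Qed.

Let p_sum : \sum_a p a = 1.
Proof. by rewrite -mulr_suml divff// gt_eqF. Qed.

Let p_le a : p a <= Y^-1 * (Q [:: a] / K * expR (- G a)) `^ t.
Proof. by rewrite Q1 mulrC. Qed.

Let eta01 : 0 < Y^-1 < 1.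
Proof. by rewrite invr_gt0 Y_gt0 invf_lt1. Qed.

Let C1_ge1 : 1 <= d%:R :> R. Proof. by rewrite ler1n. Qed.

Let mass := mass Q G p t d%:R.

Lemma orbit_sum_le_cost n om :
  orbit_sum phi f (n * m) (path om) <= cost G (mkseq om n).
Proof.
elim: n => [|n IH]; first by rewrite /orbit_sum big_ord0 /cost big_nil.
rewrite mulSnr orbit_sumD mkseqS cost_rcons; apply: lerD => //.
rewrite /path shiftn_block_path// -/(path _).
have := orbit_sum_le_low d_gt0 cd f_gt0 f_tempered m (path (shiftn n om)).
by rewrite mkseq_block_path1// /shiftn addn0.
Qed.

Lemma coding_path n om :
  pi (path om) = phiw (flat wd (mkseq om n)) (pi (path (shiftn n om))).
Proof.
rewrite (coding_shiftn d_gt0 cd (n * m)) /path mkseq_block_path//.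
by rewrite shiftn_block_path.
Qed.

(** A return of the sequence of blocks is a return of the point: the two points
    share a cylinder smaller than the required radius. *)
Lemma path_recurrent om : (forall n, 0 < mass (mkseq om n)) ->
  limit_set_uniq phi (pi (path om)) -> recurrence_set phi f (pi (path om)).
Proof.
move=> omm Jx; split => //; apply: infinite_set_unbounded => N.
have [n Nn [k ek Qk]] := path_returns t_gt0 K_gt0 C1_ge1 eta01
  (ltac:(by rewrite rho_gt0 rho_lt1) : 0 < rho < 1) Q_gt0 Q_nil Q_cat Q_le G_ge0
  p_gt0 p_sum p_le omm N.
exists (n * m)%N; first by apply: leq_trans Nn _; rewrite leq_pmulr.
rewrite /= (iter_shift_map_coding d_gt0 cd)// (birkhoff_sum_coding d_gt0 cd)//.
rewrite /path shiftn_block_path// -!/(path _).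
apply: lt_le_trans (_ : expR (- cost G (mkseq om n)) <= _); last first.
  by rewrite ler_expR lerN2 orbit_sum_le_cost.
apply: le_lt_trans Qk.
rewrite (coding_path k (shiftn n om)) ek (coding_path k om).
have c0 := coding_cube d_gt0 cd.
apply: le_trans (phi_word_lipschitz d_gt0 cd _ (c0 _) (c0 _)) _.
by rewrite mulrC ler_wpM2r ?enorm_cube_le// (ltW (Q_gt0 _)).
Qed.

(** A cover with a small sum is avoided by the point of some path of positive
    mass, and such a point recurs as soon as its coding is unique. *)
Lemma recurrence_not_negligible : exists2 eps, 0 < eps &
  forall U : nat -> set E, (\sum_(0 <= k <oo) diam_pow t (U k) <= eps%:E)%E ->
  ~ (recurrence_set phi f `|` (limit_set phi `\` limit_set_uniq phi)
     `<=` \bigcup_k U k).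
Proof.
have rho01 : 0 < rho < 1 by rewrite rho_gt0 rho_lt1.
have m_ge0 u : 0 <= mass u by exact: mass_ge0.
have m_add u : \sum_a mass (rcons u a) = mass u by exact: mass_additive.
have m_le := mass_le t_gt0 K_gt0 C1_ge1 c_gt0 eta01 Q_gt0 Q_nil Q_cat Q_ge G_ge0
  p_gt0 p_sum p_le.
have C0 : 0 < mass_constant t K d%:R c by rewrite lt_max ltr01.
have c0 : 0 < c / K by rewrite divr_gt0.
have b0 : 0 < (4 * K)^-1 by rewrite invr_gt0 mulr_gt0.
have Q_rcons u a : c / K * Q u <= Q (rcons u a).
  rewrite mulrAC ler_pdivrMr// (mulrC (Q (rcons _ _))) -cats1.
  by apply: le_trans (Q_cat u [:: a]); rewrite mulrC ler_wpM2l ?Q_ge// (ltW (Q_gt0 u)).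
pose z u := phiw (flat wd u) midcube.
have P_near om n : enorm (pi (path om) - z (mkseq om n)) <= d%:R * Q (mkseq om n).
  rewrite (coding_path n); have cc := coding_cube d_gt0 cd (path (shiftn n om)).
  apply: le_trans (phi_word_lipschitz d_gt0 cd _ cc cube_midcube) _.
  by rewrite mulrC ler_wpM2r ?(ltW (Q_gt0 _)) ?enorm_cube_le//; exact: cube_midcube.
have z_sep u v : ~~ prefix u v -> ~~ prefix v u ->
    (4 * K)^-1 * Q u <= enorm (z v - z u).
  move=> uv vu; apply: (cylinder_midpoints_separated d_gt0 cd).
    by rewrite (prefix_flat m_gt0).
  by rewrite (prefix_flat m_gt0).
have [eps eps0 H] := mass_distribution d_gt0 (P := fun om => pi (path om)) t_gt0
  C0 c0 b0 (ler0n R d) rho01 m_ge0 (erefl : mass [::] = 1) m_add m_le Q_gt0 Q_nil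
  Q_le Q_cat_le Q_rcons P_near z_sep.
exists eps => // U hU cov; have [om [om_mass nU]] := H U hU.
have [Jx|nJx] := pselect (limit_set_uniq phi (pi (path om))).
  have [k _ Uk] := cov _ (or_introl (path_recurrent om_mass Jx)).
  exact: nU Uk.
have [|k _ Uk] := cov (pi (path om)); last exact: nU Uk.
by right; split => //; exists (path om).
Qed.

End FiniteBlocks.


Let seq_pressure t n : \bar R := ((n%:R^-1)%:E * lne (sample_sum phi f xi t n))%E.

(** The limit of a divergent sequence is 0 by default, so a positive value shows
    convergence. *)
Lemma pressure_gt0_frequently t : (0 < pressure phi xi f t)%E ->
  exists2 eta : R, 0 < eta &
    forall N, exists2 n, (N < n)%N & (eta%:E < seq_pressure t n)%E.
Proof.
rewrite pressureE -/(seq_pressure t) => h.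
have [cv|ncv] := pselect (cvgn (seq_pressure t)); last first.
  suff : limn (seq_pressure t) = 0%E by move=> e; rewrite e ltxx in h.
  by apply: getPN => l cl; apply: ncv; apply/cvg_ex; exists l.
have [eta eta0 etal] : exists2 eta : R, 0 < eta & (eta%:E < limn (seq_pressure t))%E.
  move: h; case: (limn _) => [r|_|//].
    rewrite lte_fin => r0; exists (r / 2); first by rewrite divr_gt0.
    by rewrite lte_fin ltr_pdivrMr// ltr_pMr// ltr1n.
  by exists 1 => //; exact: ltry.
exists eta => // N; apply: contrapT => nex.
move: etal; rewrite ltNge => /negP; apply; apply: lime_le => //.
exists N.+1 => // n /= Nn; rewrite leNgt; apply/negP => hn; apply: nex.
by exists n.
Qed.

(** Along large [m] with [sample_sum t m] at least exponential, the correction in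
    [block_weight] is only [expR (o(m))]; the sum over all words of length [m]
    exceeds 1, hence so does a finite partial sum. *)
Lemma blocks_exist t : 0 < t -> (0 < pressure phi xi f t)%E ->
  exists m (A : finType) (wd : A -> seq L), [/\ (0 < m)%N, injective wd,
    forall a, size (wd a) = m & 1 < \sum_a block_weight m (wd a) `^ t].
Proof.
move=> t0 /pressure_gt0_frequently[eta eta0 freq].
have small : \forall n \near \oo, t * (ln K * n%:R^-1 + Vs n / n%:R) < eta.
  have inv0 : n%:R^-1 @[n --> \oo] --> (0 : R).
    apply/gtr0_cvgV0; last exact: cvgr_idn.
    by near=> n; rewrite ltr0n; near: n; exists 1%N.
  have h : t * (ln K * n%:R^-1 + Vs n / n%:R) @[n --> \oo] --> (t * (ln K * 0 + 0) : R).
    apply: cvgMl_tmp; apply: cvgD; first exact: cvgMl_tmp.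
    exact: cylvar_sum_mean.
  rewrite mulr0 addr0 mulr0 in h; exact: cvgr_lt h _ eta0.
have [N _ hN] := small; have [m Nm hm] := freq N.
have m0 : (0 < m)%N by apply: leq_ltn_trans Nm.
have mp : 0 < m%:R :> R by rewrite ltr0n.
have {}hN : t * (ln K + Vs m) < m%:R * eta.
  have := hN m (ltnW Nm); rewrite -mulrDl mulrA ltr_pdivrMr//.
  by rewrite (mulrC eta).
have Zbig : ((expR (m%:R * eta))%:E < sample_sum phi f xi t m)%E.
  move: hm; rewrite /seq_pressure lte_pdivlMl// -EFinM.
  case: (sample_sum phi f xi t m) => [r|_|]; last by rewrite le0_lneNy// leNye.
    have [r0|r0] := leP r 0; first by rewrite le0_lneNy// lee_fin.
    rewrite lne_EFin// !lte_fin => h; rewrite -(@lnK _ r) ?posrE// ltr_expR.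
    exact: h.
  exact: ltry.
pose cc := K^-1 * expR (- Vs m).
have cc0 : 0 < cc by rewrite mulr_gt0 ?invr_gt0 ?expR_gt0.
pose B : set (seq L) := [set u | size u = m].
have big : (1 < \esum_(u in B) (block_weight m u `^ t)%:E)%E.
  have pg u : (0 <= (sample_weight phi f xi u `^ t)%:E)%E by rewrite lee_fin powR_ge0.
  apply: lt_le_trans (_ : ((cc `^ t)%:E * sample_sum phi f xi t m <= _)%E).
    rewrite -lte_pdivrMl ?powR_gt0// mule1; apply: le_lt_trans Zbig.
    rewrite lee_fin -[leLHS]lnK ?posrE ?invr_gt0 ?powR_gt0// ler_expR.
    rewrite lnV ?posrE ?powR_gt0// ln_powR lnM ?posrE ?invr_gt0 ?expR_gt0//.
    by rewrite lnV ?posrE// expRK; move: hN; lra.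
  rewrite sample_sumE; apply: le_trans (esum_scale_ge _ (powR_gt0 t cc0) pg) _.
  apply: le_esum => u /= um; rewrite -EFinM lee_fin.
  have u0 : u != [::] by rewrite -size_eq0 um -lt0n.
  have sw0 : 0 < sample_weight phi f xi u by exact: (sample_weight_gt0 d_gt0 cd).
  rewrite -powRM ?(ltW cc0) ?(ltW sw0)//.
  apply: ge0_ler_powR; rewrite ?nnegrE ?(ltW t0) ?(ltW (block_weight_gt0 m u))
    ?(ltW (mulr_gt0 cc0 sw0))//.
  have sw := sample_weight_le d_gt0 cd f_gt0 xi_choice u0.
  have <- : cc * weight phi f u = block_weight m u.
    by rewrite /cc /weight /block_weight opprD expRD; ring.
  by rewrite ler_pM2l.
have [_ [X [finX XB] <-]] := ereal_sup_gt big.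
rewrite fsbig_finite//= sumEFin lte_fin => X1.
exists m, (fset_set X), (fun a => fsval a); split => //.
- exact: val_inj.
- move=> a; apply: XB; by have := fsvalP a; rewrite in_fset_set// => /set_mem.
- by rewrite -(big_seq_fsetE _ _ xpredT (fun u => block_weight m u `^ t)).
Unshelve. all: by end_near. Qed.

(** Otherwise some exponent [t] below [s_exponent] exceeds both dimensions, and
    the union of the two sets has covers with arbitrarily small sums. *)
Lemma s_exponent_le_dim :
  (hausdorff_dim (limit_set phi `\` limit_set_uniq phi) < s_exponent phi xi f)%E ->
  (s_exponent phi xi f <= hausdorff_dim (recurrence_set phi f))%E.
Proof.
move=> hJ; rewrite leNgt; apply/negP => hR.
set S := s_exponent phi xi f in hJ hR.
have [t [t0 Jt Rt tS]] : exists t : R, [/\ 0 < t,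
    (hausdorff_dim (limit_set phi `\` limit_set_uniq phi) < t%:E)%E,
    (hausdorff_dim (recurrence_set phi f) < t%:E)%E & (t%:E < S)%E].
  have fin (B : set E) : (hausdorff_dim B < S)%E -> hausdorff_dim B \is a fin_num.
    by move=> h; rewrite ge0_fin_numE ?hausdorff_dim_ge0// (lt_le_trans h (leey _)).
  have pos (B : set E) : 0 <= fine (hausdorff_dim B).
    by rewrite fine_ge0 ?hausdorff_dim_ge0.
  have Jf := fineK (fin _ hJ); have Rf := fineK (fin _ hR).
  move: hJ hR (pos (limit_set phi `\` limit_set_uniq phi)) (pos (recurrence_set phi f)).
  rewrite -Jf -Rf {Jf Rf} /=.
  move: (fine _) (fine _) => a b; case: S {fin} => [r||] aS bS a0 b0 //.
    rewrite !lte_fin in aS bS.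
    have [M [aM bM Mr]] : exists M, [/\ a <= M, b <= M & M < r].
      by exists (Order.max a b); rewrite !le_max !lexx orbT gt_max aS bS.
    by exists ((M + r) / 2); split; rewrite ?lte_fin; lra.
  exists (a + b + 1).
  by split; rewrite ?lte_fin ?ltry//; lra.
have Pt : (0 < pressure phi xi f t)%E.
  rewrite ltNge; apply/negP => h; move: tS; rewrite ltNge => /negP; apply.
  by apply: ereal_inf_lbound; exists t => //; split => //; exact: ltW.
have [m [A [wd [m0 inj sz sum1]]]] := blocks_exist t0 Pt.
have [eps eps0 H] := recurrence_not_negligible m0 inj sz t0 sum1.
have e20 : 0 < eps / 2 by rewrite divr_gt0.
have [U RU Us] := hausdorff_dim_lt_cover Rt e20.
have [U' JU Us'] := hausdorff_dim_lt_cover Jt e20.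
have [W cW Ws] := cover_union RU JU (ltW e20) Us Us'.
by apply: (H W) cW; rewrite -splitr in Ws.
Qed.

End LowerBound.

(** * The dimension formula *)

Theorem theorem1p5 (R : realType) (d : nat) (hd : (0 < d)%N)
    (L : countType) (phi : L -> 'rV[R]_d -> 'rV[R]_d)
    (hphi : is_conformal_ifs phi)
    (f : 'rV[R]_d -> R) (hf : forall x, cube x -> 0 < f x)
    (hdist : tempered_distortion phi f)
    (xi : seq L -> 'rV[R]_d) (hxi : cylinder_choice phi xi)
    (hs : (hausdorff_dim (limit_set phi `\` limit_set_uniq phi)
             < s_exponent phi xi f)%E) :
  hausdorff_dim (recurrence_set phi f) = s_exponent phi xi f.
Proof.
have [rho [K [V cd]]] := conformal_ifs_data hd hphi.
have [[[i0 _] _ _ _] _ _ _] := hphi.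
apply/eqP; rewrite eq_le (recurrence_dim_le hd cd hf hdist hxi i0)/=.
exact: (s_exponent_le_dim hd cd hf hdist hxi i0 hs).
Qed.
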